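(* Let $p\ge 1$ and $j\ge 1$ be coprime integers, let $r$ be an integer with $0\le 2r\le 2p+j-2$, and let $s,t\in\mathbb{Z}$. Then the string functions for $(p,p')=(p,2p+j)$ satisfy \begin{align*} & (q)_{\infty}^{3}C_{2jt+2s,2r}^{(p,2p+j)}(q)-(q)_{\infty}^{3}C_{2s,2r}^{(p,2p+j)}(q)\\ &\quad = (-1)^{p}q^{-\frac{1}{8}+\frac{p(2r+1)^2}{4(2p+j)}}\,q^{\binom{p}{2}-p(r-s)-\frac{p}{j}s^2}\sum_{i=1}^{t}q^{-2pj\binom{i}{2}-2psi} \\ &\qquad \times \sum_{m=1}^{p-1}(-1)^{m}q^{\binom{m+1}{2}+m(r-p)}\left ( q^{m(ji+s-j)}-q^{-m(ji+s)}\right )\\ &\qquad \times \Big ( j(-q^{m(2p+j)+p(2r+1)};q^{2p(2p+j)} )- q^{m(2p+j)-m(2r+1)}j(-q^{-m(2p+j)+p(2r+1)};q^{2p(2p+j)})\Big ). \end{align*}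
   Context: Throughout $q=e^{2\pi i\tau}$ with $\operatorname{Im}\tau>0$, $q^{a}:=e^{2\pi i a\tau}$ for rational $a$, and $z=e^{2\pi i w}$, $z^{a}:=e^{2\pi i a w}$. Also $(q)_\infty=\prod_{n\ge1}(1-q^n)$, $\binom{n}{2}=n(n-1)/2$ for all $n\in\mathbb{Z}$, and the theta function is $j(x;q):=\sum_{n\in\mathbb{Z}}(-1)^nq^{\binom n2}x^n$ (the letter $j$ without arguments is an integer). Empty sums are $0$, and when $b<a$ the convention $\sum_{i=a}^{b}c_i:=-\sum_{i=b+1}^{a-1}c_i$ is used (so for $t\le 0$, $\sum_{i=1}^{t}c_i=-\sum_{i=t+1}^{0}c_i$). Characters: for coprime integers $p\ge1$, $p'\ge 2$ put $N=p'/p-2$, and let $0\le\ell\le p'-2$. The character of the admissible irreducible highest weight $A_1^{(1)}$-module of level $N$ and spin $\ell$ is (Weyl–Kac formula) $$\chi_{\ell}^{(p,p')}(z;q)=\frac{\Theta_{\ell+1,p'}(z;q^p)-\Theta_{-(\ell+1),p'}(z;q^p)}{\Theta_{1,2}(z;q)-\Theta_{-1,2}(z;q)},\qquad \Theta_{n,m}(z;q)=\sum_{k\in\mathbb{Z}+n/(2m)}q^{mk^2}z^{-mk}.$$ It is holomorphic in the annulus $|q|<|z|<|q|^{-1}$. String functions: for $N\neq0$ and $m\in2\mathbb{Z}+\ell$, $C_{m,\ell}^{(p,p')}(q)=C^N_{m,\ell}(q)$ is defined by the expansion in that annulus $$\chi_\ell^{(p,p')}(z;q)=\sum_{m\in2\mathbb{Z}+\ell}C_{m,\ell}^{(p,p')}(q)\,q^{\frac{m^2}{4N}}z^{-\frac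 m2}.$$ *)

(* Defs.v *)
From Stdlib Require Import Reals ZArith Znumtheory ClassicalEpsilon.
From Coquelicot Require Import Coquelicot.

Open Scope R_scope.

Coercion IZR : Z >-> R.

Definition Cexp (z : C) : C := (exp (Re z) * cos (Im z), exp (Re z) * sin (Im z)).

(* [epow w a] is z^a := e^(2 pi i a w), where z = e^(2 pi i w); fractional
   powers depend on w and not only on z.  In particular [epow tau a] is q^a. *)
Definition epow (w : C) (a : R) : C := Cexp (RtoC (2 * PI * a) * Ci * w)%C.
Arguments epow w%_C a%_R.

Definition Cpowz (x : C) (n : Z) : C :=
  match n with
  | Z0 => RtoC 1
  | Zpos k => Cpow x (Pos.to_nat k)
  | Zneg k => Cinv (Cpow x (Pos.to_nat k))
  end.
Arguments Cpowz x%_C n%_Z.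

(* n (n - 1) is even, so the division is exact, also for n < 0. *)
Definition binom2 (n : Z) : Z := (n * (n - 1) / 2)%Z.

(* sum_(i = a)^b c_i, extended to b < a by - sum_(i = b + 1)^(a - 1) c_i. *)
Definition range_sum (a b : Z) (c : Z -> C) : C :=
  let sum_from lo len : C :=
    sum_n_m (G := C_AbelianMonoid) (fun k => c (lo - 1 + Z.of_nat k)%Z) 1 len in
  if (a <=? b)%Z then sum_from a (Z.to_nat (b - a + 1))
  else Copp (sum_from (b + 1)%Z (Z.to_nat (a - 1 - b))).
Arguments range_sum a%_Z b%_Z c%_function_scope.

(* A series over Z converges when both of its halves do. *)
Definition is_Zseries (f : Z -> C) (l : C) : Prop :=
  exists a b : C,
    is_series (V := C_NormedModule) (fun n : nat => f (Z.of_nat n)) a /\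
    is_series (V := C_NormedModule) (fun n : nat => f (- Z.of_nat (S n))%Z) b /\
    l = (a + b)%C.

Definition Zseries (f : Z -> C) : C :=
  @iota (CompleteNormedModule.CompleteSpace _ C_CompleteNormedModule) (is_Zseries f).

Fixpoint qpoch (q : C) (n : nat) : C :=
  match n with
  | O => RtoC 1
  | S k => (qpoch q k * (1 - Cpow q (S k)))%C
  end.

Definition qpoch_inf (q : C) : C :=
  @iota (CompleteNormedModule.CompleteSpace _ C_CompleteNormedModule)
    (fun l => filterlim (qpoch q) eventually (@locally C_UniformSpace l)).

Definition jtheta (x q : C) : C :=
  Zseries (fun n => Cpowz (- (1)) n * Cpowz q (binom2 n) * Cpowz x n)%C.

(* Theta_{n,m}(z; q) at z = e^(2 pi i w), q = e^(2 pi i tau); passing from q to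
   q^p amounts to replacing tau by p tau. *)
Definition Theta (n m : Z) (w tau : C) : C :=
  Zseries (fun i => let k := i + n / (2 * m) in
                    (epow tau (m * k ^ 2) * epow w (- m * k))%C).
Arguments Theta n%_Z m%_Z w%_C tau%_C.

Definition weyl_denominator (w tau : C) : C :=
  (Theta 1 2 w tau - Theta (-1) 2 w tau)%C.

Definition character (p p' l : Z) (w tau : C) : C :=
  ((Theta (l + 1) p' w (p * tau) - Theta (- (l + 1)) p' w (p * tau))
   / weyl_denominator w tau)%C.

Definition level (p p' : Z) : R := p' / p - 2.

(* c is the family of coefficients, for m = 2 n + l, of the expansion of the
   character in |q| < |z| < |q|^(-1).  At the zeros of the Weyl denominator the
   character is only defined by removing the singularity, so the expansion is
   required away from them; this still determines the coefficients. *)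
Definition is_string_family (p p' l : Z) (tau : C) (c : Z -> C) : Prop :=
  forall w : C,
    Cmod (epow tau 1) < Cmod (epow w 1) < / Cmod (epow tau 1) ->
    weyl_denominator w tau <> RtoC 0 ->
    is_Zseries
      (fun n => let m := (2 * n + l)%Z in
                (c m * epow tau (m ^ 2 / (4 * level p p')) * epow w (- m / 2))%C)
      (character p p' l w tau).

(* C_{m,l}^{(p,p')}(q); meaningful only when m - l is even, the other values of
   the chosen family being unconstrained. *)
Definition string_function (p p' m l : Z) (tau : C) : C :=
  epsilon (inhabits (fun _ : Z => RtoC 0)) (is_string_family p p' l tau) m.
Arguments string_function p%_Z p'%_Z m%_Z l%_Z tau%_C.

(* Main.v *)
(* The partial theta series g_k (recip_coef k below) satisfy g_k + q^(k+1) g_(k+1) = 1; hence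
   g * theta, with theta_n = (-1)^n q^C(n,2), is supported at 0, its value there being the sum of
   the partial sums of theta, that is - sum n theta_n = (q)_oo^3 (Jacobi).  So sum g_k z^k is
   (q)_oo^3 / j(z; q) on |q| < |z| < 1, and convolving g with the coefficients of the Weyl
   numerator, which vanishes at z = 1, gives coefficients decaying like q^|m|, hence the
   expansion of the character on the whole annulus and (q)_oo^3 C_{m,l} explicitly.
   Iterating the recursion 2p times expresses g_k through g_(k+2p) and 2p powers of q^k; since
   z -> q^(2p) z maps the character to z^j times itself up to a power of q, the g_(k+2p) terms
   of consecutive string functions cancel, and what remains is the numerator at z = q^-n for
   0 <= n < 2p.  It vanishes at n = 0 and n = p, and the terms p + m and p - m pair up.  The
   sum over i telescopes these steps. *)

Require Import Defs.
From Stdlib Require Import Reals ZArith Znumtheory.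
From Stdlib Require Import ClassicalEpsilon FunctionalExtensionality Lra Lia.
From Coquelicot Require Import Coquelicot.

Open Scope R_scope.

(** * Absolutely convergent series over Z *)

(** The whole argument lives on coefficients of absolutely convergent series over Z, with Gaussian
    or geometric majorants; neither holomorphy nor contour integrals enter. Two obstacles shape it.
    String functions are chosen by [epsilon], so an explicit family must be shown both to expand the
    character and to be the only one doing so. For uniqueness the strip 0 < Im w < Im tau suffices,
    and there the Weyl denominator has no zero because the reciprocal series converges and its
    product with theta is a nonzero constant. Secondly, 1 / j(z; q) has a pole at z = 1, in the
    middle of the annulus: its coefficients g_k tend to 1 as k -> +oo. So the reciprocal is never
    multiplied with the numerator as a function on the annulus; the convolution is formed on
    coefficients and only its decay is estimated. Jacobi's identity comes from truncated theta sums
    with two cut-off parameters, where it is a consequence of q-Pascal recursions, and a dominated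
    limit. The number 2p is forced by the spacing p' = 2p + j of the numerator exponents: 2p steps
    of the recursion and j steps of the index make up one step in the numerator. *)

Definition Clim (u : nat -> C) (l : C) : Prop :=
  is_lim_seq (fun n => Cmod (u n - l)) 0.

(** Pairing n with -(n + 1) follows the two halves in [is_Zseries] and meets every integer exactly
    once; [Znorm] is thus the l^1 norm. *)
Definition Zabs (f : Z -> C) (n : nat) : R :=
  Cmod (f (Z.of_nat n)) + Cmod (f (- Z.of_nat (S n))%Z).

Definition Zfold (f : Z -> C) (n : nat) : C :=
  (f (Z.of_nat n) + f (- Z.of_nat (S n))%Z)%C.

Definition summable (f : Z -> C) : Prop := ex_series (Zabs f).

Definition Znorm (f : Z -> C) : R := Series (Zabs f).

Notation is_Cseries := (is_series (V := C_NormedModule)).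

Lemma filterlim_Clim (u : nat -> C) (l : C) :
  filterlim u eventually (@locally C_UniformSpace l) <-> Clim u l.
Proof.
  split; intros H.
  - apply is_lim_seq_spec. intros eps.
    destruct (proj1 (filterlim_locally_ball_norm (U := C_NormedModule) u l) H eps) as [N HN].
    exists N. intros n Hn. specialize (HN n Hn).
    rewrite Rminus_0_r, Rabs_pos_eq by apply Cmod_ge_0. exact HN.
  - apply (filterlim_locally_ball_norm (U := C_NormedModule)). intros eps.
    destruct (proj2 (is_lim_seq_spec _ _) H eps) as [N HN]. exists N.
    intros n Hn. specialize (HN n Hn). cbv beta in HN.
    rewrite Rminus_0_r, Rabs_pos_eq in HN by apply Cmod_ge_0. exact HN.
Qed.

Lemma is_Cseries_Clim (f : nat -> C) (l : C) :
  is_Cseries f l <-> Clim (fun n => sum_n (G := C_AbelianMonoid) f n) l.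
Proof. apply filterlim_Clim. Qed.

Lemma Clim_unique (u : nat -> C) (a b : C) : Clim u a -> Clim u b -> a = b.
Proof.
  intros Ha Hb.
  assert (H : is_lim_seq (fun _ => Cmod (a - b)) 0).
  { apply is_lim_seq_le_le with (fun _ => 0) (fun n => Cmod (u n - b) + Cmod (u n - a)).
    - intros n. split. apply Cmod_ge_0.
      replace (a - b)%C with ((u n - b) + - (u n - a))%C by ring.
      rewrite <- (Cmod_opp (u n - a)). apply Cmod_triangle.
    - apply is_lim_seq_const.
    - replace (Finite 0) with (Finite (0 + 0)) by (f_equal; ring).
      apply is_lim_seq_plus'; assumption. }
  apply is_lim_seq_unique in H. rewrite Lim_seq_const in H.
  injection H as H. apply Cmod_eq_0 in H.
  replace a with (b + (a - b))%C by ring. rewrite H. ring.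
Qed.

Lemma Clim_const (a : C) : Clim (fun _ => a) a.
Proof.
  unfold Clim. apply is_lim_seq_ext with (fun _ => 0).
  intros _. replace (a - a)%C with (RtoC 0) by ring. now rewrite Cmod_0.
  apply is_lim_seq_const.
Qed.

Lemma Clim_ext (u v : nat -> C) (l : C) : (forall n, u n = v n) -> Clim u l -> Clim v l.
Proof. intros E. apply is_lim_seq_ext. intros n. now rewrite E. Qed.

Lemma Clim_plus (u v : nat -> C) (a b : C) :
  Clim u a -> Clim v b -> Clim (fun n => u n + v n)%C (a + b)%C.
Proof.
  intros Ha Hb. unfold Clim.
  apply is_lim_seq_le_le with (fun _ => 0) (fun n => Cmod (u n - a) + Cmod (v n - b)).
  - intros n. split. apply Cmod_ge_0.
    replace (u n + v n - (a + b))%C with ((u n - a) + (v n - b))%C by ring. apply Cmod_triangle.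
  - apply is_lim_seq_const.
  - replace (Finite 0) with (Finite (0 + 0)) by (f_equal; ring).
    apply is_lim_seq_plus'; assumption.
Qed.

Lemma Clim_scal (c : C) (u : nat -> C) (a : C) :
  Clim u a -> Clim (fun n => c * u n)%C (c * a)%C.
Proof.
  intros Ha. unfold Clim.
  apply is_lim_seq_ext with (fun n => Cmod c * Cmod (u n - a)).
  - intros n. rewrite <- Cmod_mult. f_equal. ring.
  - replace (Finite 0) with (Rbar_mult (Cmod c) 0) by (simpl; f_equal; ring).
    now apply is_lim_seq_scal_l.
Qed.

Lemma Clim_bounded (u : nat -> C) (l : C) (M : R) :
  Clim u l -> (forall n, Cmod (u n) <= M) -> Cmod l <= M.
Proof.
  intros H HM.
  assert (K : Rbar_le (Cmod l - M) 0); [| simpl in K; lra].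
  apply is_lim_seq_le with (fun _ => Cmod l - M) (fun n => Cmod (u n - l)).
  - intros n. specialize (HM n).
    replace l with (u n + - (u n - l))%C at 1 by ring.
    generalize (Cmod_triangle (u n) (- (u n - l))). rewrite (Cmod_opp (u n - l)). lra.
  - apply is_lim_seq_const.
  - exact H.
Qed.

Lemma Clim_mult (u v : nat -> C) (a b : C) :
  Clim u a -> Clim v b -> (exists M, forall n, Cmod (u n) <= M) ->
  Clim (fun n => u n * v n)%C (a * b)%C.
Proof.
  intros Ha Hb [M HM]. unfold Clim.
  apply is_lim_seq_le_le with (fun _ => 0)
    (fun n => M * Cmod (v n - b) + Cmod b * Cmod (u n - a)).
  - intros n. split. apply Cmod_ge_0.
    replace (u n * v n - a * b)%C with (u n * (v n - b) + b * (u n - a))%C by ring.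
    eapply Rle_trans; [apply Cmod_triangle |]. rewrite !Cmod_mult.
    apply Rplus_le_compat_r, Rmult_le_compat_r; [apply Cmod_ge_0 | apply HM].
  - apply is_lim_seq_const.
  - replace (Finite 0) with (Rbar_plus (Rbar_mult M 0) (Rbar_mult (Cmod b) 0))
      by (simpl; f_equal; ring).
    apply is_lim_seq_plus' with (l1 := M * 0) (l2 := Cmod b * 0);
      apply is_lim_seq_scal_l with (lu := Finite 0); assumption.
Qed.

Lemma sum_n_Cmod_le (f : nat -> C) (b : nat -> R) (N : nat) :
  (forall n, Cmod (f n) <= b n) ->
  Cmod (sum_n (G := C_AbelianMonoid) f N) <= sum_n b N.
Proof.
  intros H. induction N as [| N IH].
  - rewrite !sum_O. apply H.
  - rewrite !sum_Sn. eapply Rle_trans; [apply Cmod_triangle |].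
    apply Rplus_le_compat; [apply IH | apply H].
Qed.

Lemma sum_n_le_Series (b : nat -> R) (N : nat) :
  (forall n, 0 <= b n) -> ex_series b -> sum_n b N <= Series b.
Proof.
  intros Hb Hex.
  assert (H : is_lim_seq (fun n => sum_n b n) (Series b)) by (apply Series_correct, Hex).
  apply (is_lim_seq_incr_compare _ _ H).
  intros n. rewrite sum_Sn. unfold plus; simpl. generalize (Hb (S n)). lra.
Qed.

Lemma is_Cseries_Cmod_le (f : nat -> C) (l : C) (b : nat -> R) :
  is_Cseries f l -> (forall n, Cmod (f n) <= b n) -> ex_series b -> Cmod l <= Series b.
Proof.
  intros Hf Hb Hex. apply is_Cseries_Clim in Hf.
  apply (Clim_bounded _ _ _ Hf). intros n.
  eapply Rle_trans; [apply sum_n_Cmod_le, Hb |].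
  apply sum_n_le_Series; trivial. intros k. eapply Rle_trans; [apply Cmod_ge_0 | apply Hb].
Qed.

Lemma is_Zseries_fold (f : Z -> C) (l : C) : is_Zseries f l -> is_Cseries (Zfold f) l.
Proof.
  intros [a [b [Ha [Hb ->]]]]. apply (is_series_plus _ _ _ _ Ha Hb).
Qed.

Lemma is_Zseries_unique (f : Z -> C) (a b : C) : is_Zseries f a -> is_Zseries f b -> a = b.
Proof.
  intros Ha Hb. apply is_Zseries_fold in Ha, Hb.
  apply is_Cseries_Clim in Ha, Hb. now apply (Clim_unique _ _ _ Ha).
Qed.

Lemma Zseries_eq (f : Z -> C) (l : C) : is_Zseries f l -> Zseries f = l.
Proof.
  intros H. apply (iota_unique (V := C_CompleteNormedModule)); [| exact H].
  intros y Hy. exact (is_Zseries_unique _ _ _ Hy H).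
Qed.

Lemma ex_series_ge_0_le (a b : nat -> R) :
  (forall n, 0 <= a n <= b n) -> ex_series b -> ex_series a.
Proof.
  intros H. apply (ex_series_le (V := R_CompleteNormedModule)). intros n.
  change (Rabs (a n) <= b n). rewrite Rabs_pos_eq; apply H.
Qed.

Lemma Zabs_ge_0 (f : Z -> C) (n : nat) : 0 <= Zabs f n.
Proof. unfold Zabs. generalize (Cmod_ge_0 (f (Z.of_nat n))) (Cmod_ge_0 (f (- Z.of_nat (S n))%Z)). lra. Qed.

Lemma summable_halves (f : Z -> C) :
  summable f <->
  ex_series (fun n => Cmod (f (Z.of_nat n))) /\
  ex_series (fun n => Cmod (f (- Z.of_nat (S n))%Z)).
Proof.
  split.
  - intros H.
    split; apply (ex_series_ge_0_le _ _) with (2 := H); intros n; unfold Zabs;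
      generalize (Cmod_ge_0 (f (Z.of_nat n))) (Cmod_ge_0 (f (- Z.of_nat (S n))%Z)); lra.
  - intros [H1 H2]. exact (ex_series_plus _ _ H1 H2).
Qed.

Lemma ex_Cseries_abs (f : nat -> C) :
  ex_series (fun n => Cmod (f n)) -> exists l, is_Cseries f l.
Proof.
  intros H. apply (ex_series_le (V := C_CompleteNormedModule)) with (2 := H).
  intros n. apply Rle_refl.
Qed.

Lemma Zseries_correct (f : Z -> C) : summable f -> is_Zseries f (Zseries f).
Proof.
  intros H. apply summable_halves in H. destruct H as [H1 H2].
  destruct (ex_Cseries_abs _ H1) as [a Ha]. destruct (ex_Cseries_abs _ H2) as [b Hb].
  assert (H : is_Zseries f (a + b)%C) by (exists a, b; auto).
  now rewrite (Zseries_eq _ _ H).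
Qed.

Lemma summable_fold (f : Z -> C) : summable f -> is_Cseries (Zfold f) (Zseries f).
Proof. intros H. apply is_Zseries_fold, Zseries_correct, H. Qed.

(** Convergence of the folded series alone would not give that of the two halves; summability does,
    and then only the value is left to compare. *)
Lemma Zseries_fold_eq (f : Z -> C) (l : C) :
  summable f -> is_Cseries (Zfold f) l -> Zseries f = l.
Proof.
  intros H Hl. apply summable_fold in H. apply is_Cseries_Clim in H, Hl.
  exact (Clim_unique _ _ _ H Hl).
Qed.

Lemma Zseries_ext (f g : Z -> C) : (forall n, f n = g n) -> Zseries f = Zseries g.
Proof.
  intros H. f_equal. apply functional_extensionality. exact H.
Qed.

Lemma summable_ext (f g : Z -> C) : (forall n, f n = g n) -> summable f -> summable g.
Proof.
  intros H. apply ex_series_ext. intros n. unfold Zabs. now rewrite !H.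
Qed.

Lemma summable_le (M : R) (f g : Z -> C) :
  (forall n, Cmod (f n) <= M * Cmod (g n)) -> summable g -> summable f.
Proof.
  intros H Hg. apply ex_series_ge_0_le with (fun n => M * Zabs g n).
  - intros n. split; [apply Zabs_ge_0 |]. unfold Zabs.
    generalize (H (Z.of_nat n)) (H (- Z.of_nat (S n))%Z). lra.
  - apply (ex_series_scal M _ Hg).
Qed.

Lemma Zabs_plus_le (f g : Z -> C) (n : nat) :
  Zabs (fun k => f k + g k)%C n <= Zabs f n + Zabs g n.
Proof.
  unfold Zabs.
  generalize (Cmod_triangle (f (Z.of_nat n)) (g (Z.of_nat n)))
    (Cmod_triangle (f (- Z.of_nat (S n))%Z) (g (- Z.of_nat (S n))%Z)). lra.
Qed.

Lemma summable_plus (f g : Z -> C) :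
  summable f -> summable g -> summable (fun n => f n + g n)%C.
Proof.
  intros Hf Hg. apply ex_series_ge_0_le with (fun n => Zabs f n + Zabs g n).
  - intros n. split; [apply Zabs_ge_0 | apply Zabs_plus_le].
  - apply (ex_series_plus _ _ Hf Hg).
Qed.

Lemma summable_scal (c : C) (f : Z -> C) : summable f -> summable (fun n => c * f n)%C.
Proof.
  apply summable_le with (Cmod c). intros n. rewrite Cmod_mult. apply Rle_refl.
Qed.

Lemma is_Zseries_plus (f g : Z -> C) (a b : C) :
  is_Zseries f a -> is_Zseries g b -> is_Zseries (fun n => f n + g n)%C (a + b)%C.
Proof.
  intros [a1 [a2 [Ha1 [Ha2 ->]]]] [b1 [b2 [Hb1 [Hb2 ->]]]].
  exists (a1 + b1)%C, (a2 + b2)%C. repeat split.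
  - apply (is_series_plus _ _ _ _ Ha1 Hb1).
  - apply (is_series_plus _ _ _ _ Ha2 Hb2).
  - ring.
Qed.

Lemma is_Zseries_scal (c : C) (f : Z -> C) (a : C) :
  is_Zseries f a -> is_Zseries (fun n => c * f n)%C (c * a)%C.
Proof.
  intros [a1 [a2 [Ha1 [Ha2 ->]]]]. exists (c * a1)%C, (c * a2)%C. repeat split.
  - apply (is_series_scal c _ _ Ha1).
  - apply (is_series_scal c _ _ Ha2).
  - ring.
Qed.

Lemma is_Zseries_ext (f g : Z -> C) (a : C) :
  (forall n, f n = g n) -> is_Zseries f a -> is_Zseries g a.
Proof.
  intros H [a1 [a2 [Ha1 [Ha2 ->]]]]. exists a1, a2. repeat split.
  - revert Ha1. apply is_series_ext. intros n. apply H.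
  - revert Ha2. apply is_series_ext. intros n. apply H.
Qed.

Lemma Zseries_plus (f g : Z -> C) :
  summable f -> summable g -> Zseries (fun n => f n + g n)%C = (Zseries f + Zseries g)%C.
Proof. intros Hf Hg. apply Zseries_eq, is_Zseries_plus; now apply Zseries_correct. Qed.

Lemma Zseries_scal (c : C) (f : Z -> C) :
  summable f -> Zseries (fun n => c * f n)%C = (c * Zseries f)%C.
Proof. intros Hf. apply Zseries_eq, is_Zseries_scal. now apply Zseries_correct. Qed.

Lemma summable_minus (f g : Z -> C) :
  summable f -> summable g -> summable (fun n => f n - g n)%C.
Proof.
  intros Hf Hg. apply summable_plus; trivial.
  apply summable_le with 1 g; trivial. intros n. rewrite Cmod_opp. lra.
Qed.

Lemma Zseries_minus (f g : Z -> C) :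
  summable f -> summable g -> Zseries (fun n => f n - g n)%C = (Zseries f - Zseries g)%C.
Proof.
  intros Hf Hg.
  rewrite (Zseries_ext _ (fun n => f n + (- (1)) * g n)%C) by (intros; ring).
  rewrite Zseries_plus, Zseries_scal; trivial; [ring |]. now apply summable_scal.
Qed.

Lemma is_Zseries_reflect (f : Z -> C) (a : C) :
  is_Zseries f a -> is_Zseries (fun n => f (-1 - n)%Z) a.
Proof.
  intros [a1 [a2 [Ha1 [Ha2 ->]]]]. exists a2, a1. repeat split.
  - revert Ha2. apply is_series_ext. intros n. f_equal. lia.
  - revert Ha1. apply is_series_ext. intros n. f_equal. lia.
  - ring.
Qed.

Lemma is_Zseries_succ (f : Z -> C) (a : C) :
  is_Zseries f a -> is_Zseries (fun n => f (n + 1)%Z) a.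
Proof.
  (* The term at 0 passes from the nonnegative half to the negative one. *)
  intros [a1 [a2 [Ha1 [Ha2 ->]]]]. exists (a1 - f 0%Z)%C, (a2 + f 0%Z)%C. repeat split.
  - apply is_series_ext with (fun n => f (Z.of_nat (S n))); [intros n; f_equal; lia |].
    apply (is_series_incr_1 (fun n => f (Z.of_nat n))).
    change (is_Cseries (fun n => f (Z.of_nat n)) (a1 - f 0%Z + f 0%Z)%C).
    replace (a1 - f 0%Z + f 0%Z)%C with a1 by ring. exact Ha1.
  - apply is_series_decr_1.
    change (is_Cseries (fun k => f (- Z.of_nat (S (S k)) + 1)%Z) (a2 + f 0%Z - f 0%Z)%C).
    replace (a2 + f 0%Z - f 0%Z)%C with a2 by ring. revert Ha2. apply is_series_ext.
    intros n. f_equal. lia.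
  - ring.
Qed.

(** The reflection n -> -1 - n merely exchanges the two halves; composed with a unit shift it
    becomes n -> -n. *)
Lemma is_Zseries_opp_index (f : Z -> C) (a : C) :
  is_Zseries f a -> is_Zseries (fun n => f (- n)%Z) a.
Proof.
  intros H. apply is_Zseries_succ, is_Zseries_reflect in H.
  revert H. apply is_Zseries_ext. intros n. f_equal. lia.
Qed.

Lemma is_Zseries_shift (k : Z) (f : Z -> C) (a : C) :
  is_Zseries f a -> is_Zseries (fun n => f (n + k)%Z) a.
Proof.
  assert (P : forall (m : nat) (f : Z -> C), is_Zseries f a -> is_Zseries (fun n => f (n + Z.of_nat m)%Z) a).
  { induction m as [| m IH]; intros h Hh.
    - revert Hh. apply is_Zseries_ext. intros n. f_equal. lia.
    - apply is_Zseries_succ, IH in Hh. revert Hh. apply is_Zseries_ext. intros n. f_equal. lia. }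
  intros H. destruct (Z.le_ge_cases 0 k) as [Hk | Hk].
  - apply (P (Z.to_nat k)) in H. revert H. apply is_Zseries_ext. intros n. f_equal. lia.
  - apply is_Zseries_opp_index, (P (Z.to_nat (- k))), is_Zseries_opp_index in H.
    revert H. apply is_Zseries_ext. intros n. f_equal. lia.
Qed.

(** Makes shifts and reflections of the index, proved for [is_Zseries], available for [summable]. *)
Lemma summable_is_Zseries (f : Z -> C) :
  summable f <-> exists a, is_Zseries (fun n => RtoC (Cmod (f n))) a.
Proof.
  assert (E : forall u : nat -> R, (forall n, 0 <= u n) ->
    ((exists l, is_Cseries (fun n => RtoC (u n)) l) <-> ex_series u)).
  { intros u Hu. split.
    - intros H. apply (Cauchy_ex_series (V := C_CompleteNormedModule)) in H.
      apply (ex_series_Cauchy (V := R_CompleteNormedModule)).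
      intros eps. destruct (H eps) as [N HN]. exists N. intros n m Hn Hm.
      specialize (HN n m Hn Hm).
      assert (S : sum_n_m (G := C_AbelianMonoid) (fun n => RtoC (u n)) n m = RtoC (sum_n_m u n m)).
      { clear. destruct (Nat.le_gt_cases n m) as [Hnm | Hnm].
        - induction Hnm as [| m Hnm IH].
          + now rewrite !sum_n_n.
          + rewrite !sum_n_Sm by lia. rewrite IH. unfold plus; simpl. now rewrite RtoC_plus.
        - rewrite !sum_n_m_zero by lia. reflexivity. }
      change (Cmod (sum_n_m (G := C_AbelianMonoid) (fun n => RtoC (u n)) n m) < eps) in HN.
      rewrite S, Cmod_R in HN. exact HN.
    - intros H. apply ex_Cseries_abs. revert H. apply ex_series_ext. intros n.
      now rewrite Cmod_R, Rabs_pos_eq. }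
  rewrite summable_halves. split.
  - intros [H1 H2].
    apply E in H1; [| intros; apply Cmod_ge_0]. apply E in H2; [| intros; apply Cmod_ge_0].
    destruct H1 as [a Ha], H2 as [b Hb]. exists (a + b)%C. exists a, b. auto.
  - intros [l [a [b [Ha [Hb _]]]]].
    split; apply E; try (intros; apply Cmod_ge_0); [exists a | exists b]; assumption.
Qed.

Lemma summable_shift (k : Z) (f : Z -> C) : summable f -> summable (fun n => f (n + k)%Z).
Proof.
  rewrite !summable_is_Zseries. intros [a Ha]. exists a.
  apply (is_Zseries_shift k _ _ Ha).
Qed.

Lemma summable_opp_index (f : Z -> C) : summable f -> summable (fun n => f (- n)%Z).
Proof.
  rewrite !summable_is_Zseries. intros [a Ha]. exists a.
  apply (is_Zseries_opp_index _ _ Ha).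
Qed.

Lemma Zseries_shift (k : Z) (f : Z -> C) :
  summable f -> Zseries (fun n => f (n + k)%Z) = Zseries f.
Proof. intros H. apply Zseries_eq, (is_Zseries_shift k f), Zseries_correct, H. Qed.

Lemma Zseries_opp_index (f : Z -> C) :
  summable f -> Zseries (fun n => f (- n)%Z) = Zseries f.
Proof. intros H. apply Zseries_eq, (is_Zseries_opp_index f), Zseries_correct, H. Qed.

Lemma Zseries_Cmod_le (f : Z -> C) : summable f -> Cmod (Zseries f) <= Znorm f.
Proof.
  intros H. apply is_Cseries_Cmod_le with (Zfold f); trivial.
  - apply summable_fold, H.
  - intros n. apply Cmod_triangle.
Qed.

Lemma Znorm_ge_term (f : Z -> C) (k : Z) : summable f -> Cmod (f k) <= Znorm f.
Proof.
  intros H.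
  assert (T : forall n, Zabs f n <= Znorm f).
  { intros n. eapply Rle_trans; [| apply (sum_n_le_Series _ n (Zabs_ge_0 f) H)].
    destruct n as [| n]; [rewrite sum_O; lra |].
    rewrite sum_Sn. unfold plus; simpl.
    assert (0 <= sum_n (Zabs f) n); [| lra].
    clear. induction n as [| n IH]; [rewrite sum_O; apply Zabs_ge_0 |].
    rewrite sum_Sn. unfold plus; simpl. generalize (Zabs_ge_0 f (S n)). lra. }
  destruct (Z.le_gt_cases 0 k) as [Hk | Hk].
  - specialize (T (Z.to_nat k)). unfold Zabs in T. rewrite Z2Nat.id in T by lia.
    generalize (Cmod_ge_0 (f (- Z.of_nat (S (Z.to_nat k)))%Z)). lra.
  - specialize (T (Z.to_nat (- k - 1))). unfold Zabs in T.
    replace (- Z.of_nat (S (Z.to_nat (- k - 1))))%Z with k in T by lia.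
    generalize (Cmod_ge_0 (f (Z.of_nat (Z.to_nat (- k - 1))))). lra.
Qed.

Lemma Znorm_le (M : R) (f g : Z -> C) :
  (forall n, Cmod (f n) <= M * Cmod (g n)) -> summable g -> Znorm f <= M * Znorm g.
Proof.
  intros H Hg. unfold Znorm. rewrite <- Series_scal_l. apply Series_le.
  - intros n. split; [apply Zabs_ge_0 |]. unfold Zabs.
    generalize (H (Z.of_nat n)) (H (- Z.of_nat (S n))%Z). lra.
  - apply (ex_series_scal M _ Hg).
Qed.

(** * Dominated convergence and interchange of summations *)

(** The tail beyond K is at most the tail of [b], uniformly in N; the head of fixed length K tends
    to 0 termwise. *)
Lemma Series_Tannery (d : nat -> nat -> R) (b : nat -> R) :
  (forall N k, 0 <= d N k <= b k) -> ex_series b ->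
  (forall k, is_lim_seq (fun N => d N k) 0) ->
  is_lim_seq (fun N => Series (d N)) 0.
Proof.
  intros Hd Hb Hlim.
  assert (Hex : forall N, ex_series (d N)) by (intros N; apply ex_series_ge_0_le with b; trivial).
  assert (Hfin : forall K, is_lim_seq (fun N => sum_n (d N) K) 0).
  { induction K as [| K IH].
    - apply is_lim_seq_ext with (2 := Hlim 0%nat). intros N. now rewrite sum_O.
    - apply is_lim_seq_ext with (fun N => sum_n (d N) K + d N (S K)).
      + intros N. now rewrite sum_Sn.
      + replace (Finite 0) with (Finite (0 + 0)) by (f_equal; ring).
        apply is_lim_seq_plus'; auto. }
  assert (Htail : forall N K, Series (d N) <= sum_n (d N) K + (Series b - sum_n b K)).
  { intros N K.
    rewrite (Series_incr_n (d N) (S K)), (Series_incr_n b (S K)) by (auto; lia).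
    rewrite <- !sum_n_Reals. simpl Init.Nat.pred.
    assert (Series (fun k => d N (S K + k)%nat) <= Series (fun k => b (S K + k)%nat)); [| lra].
    apply Series_le; [intros; apply Hd |]. now apply (ex_series_incr_n b (S K)). }
  assert (Hb' : is_lim_seq (sum_n b) (Series b)) by (apply Series_correct, Hb).
  apply is_lim_seq_spec. intros eps.
  destruct (proj2 (is_lim_seq_spec _ _) Hb' (pos_div_2 eps)) as [K HK].
  specialize (HK K (le_n _)). apply Rabs_def2 in HK. simpl in HK.
  destruct (proj2 (is_lim_seq_spec _ _) (Hfin K) (pos_div_2 eps)) as [N0 HN].
  exists N0. intros N Hge. specialize (HN N Hge). apply Rabs_def2 in HN. simpl in HN.
  assert (0 <= Series (d N)).
  { replace 0 with (Series (fun k => 0 * d N k)) by (rewrite Series_scal_l; ring).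
    apply Series_le; auto. intros k. generalize (Hd N k). intros. rewrite Rmult_0_l. lra. }
  rewrite Rminus_0_r, Rabs_pos_eq by trivial. generalize (Htail N K). lra.
Qed.

Lemma Zseries_Tannery (f : nat -> Z -> C) (g b : Z -> C) :
  (forall N k, Cmod (f N k) <= Cmod (b k)) -> summable b ->
  (forall k, Clim (fun N => f N k) (g k)) ->
  Clim (fun N => Zseries (f N)) (Zseries g).
Proof.
  intros Hf Hb Hlim.
  assert (Hg : forall k, Cmod (g k) <= Cmod (b k)).
  { intros k. apply (Clim_bounded _ _ _ (Hlim k)). intros N. apply Hf. }
  assert (Sf : forall N, summable (f N)).
  { intros N. apply summable_le with 1 b; trivial. intros k. rewrite Rmult_1_l. apply Hf. }
  assert (Sg : summable g).
  { apply summable_le with 1 b; trivial. intros k. rewrite Rmult_1_l. apply Hg. }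
  unfold Clim. apply is_lim_seq_le_le with (fun _ => 0) (fun N => Znorm (fun k => f N k - g k)%C).
  - intros N. split; [apply Cmod_ge_0 |].
    rewrite <- Zseries_minus by trivial. apply Zseries_Cmod_le. now apply summable_minus.
  - apply is_lim_seq_const.
  - apply Series_Tannery with (fun n => 2 * Zabs b n).
    + intros N k. split; [apply Zabs_ge_0 |].
      assert (Q : forall m, Cmod (f N m - g m) <= 2 * Cmod (b m)).
      { intros m. eapply Rle_trans; [apply Cmod_triangle |]. rewrite Cmod_opp.
        generalize (Hf N m) (Hg m). lra. }
      unfold Zabs. generalize (Q (Z.of_nat k)) (Q (- Z.of_nat (S k))%Z). lra.
    + apply (ex_series_scal 2 _ Hb).
    + intros k. unfold Zabs.
      replace (Finite 0) with (Finite (0 + 0)) by (f_equal; ring).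
      apply is_lim_seq_plus'; apply Hlim.
Qed.

(** Tonelli: a partial sum over the columns is the series over i of finite row sums, so these
    partial sums increase and stay below the total. *)
Lemma Series_swap_ex (a : nat -> nat -> R) :
  (forall i k, 0 <= a i k) -> (forall i, ex_series (a i)) ->
  ex_series (fun i => Series (a i)) ->
  (forall k, ex_series (fun i => a i k)) /\
  ex_series (fun k => Series (fun i => a i k)).
Proof.
  intros Ha Hr Ht.
  assert (Hs : forall i N, sum_n (a i) N <= Series (a i)) by (intros; now apply sum_n_le_Series).
  assert (Hs0 : forall i N, 0 <= sum_n (a i) N).
  { intros i N. induction N as [| N IH]; [rewrite sum_O; apply Ha |].
    rewrite sum_Sn. unfold plus; simpl. generalize (Ha i (S N)). lra. }
  assert (Hk : forall k, ex_series (fun i => a i k)).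
  { intros k. apply ex_series_ge_0_le with (fun i => Series (a i)); trivial.
    intros i. split; trivial. eapply Rle_trans; [| apply (Hs i k)].
    destruct k as [| k]; [rewrite sum_O; lra |].
    rewrite sum_Sn. unfold plus; simpl. generalize (Hs0 i k). lra. }
  split; trivial.
  assert (Hfin : forall N, ex_series (fun i => sum_n (a i) N)).
  { intros N. apply ex_series_ge_0_le with (fun i => Series (a i)); auto. }
  assert (Hx : forall N, sum_n (fun k => Series (fun i => a i k)) N = Series (fun i => sum_n (a i) N)).
  { induction N as [| N IH].
    - rewrite sum_O. apply Series_ext. intros i. now rewrite sum_O.
    - rewrite sum_Sn, IH. unfold plus; simpl. rewrite <- Series_plus; auto.
      apply Series_ext. intros i. now rewrite sum_Sn. }
  assert (L : ex_finite_lim_seq (sum_n (fun k => Series (fun i => a i k)))).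
  { apply ex_finite_lim_seq_incr with (Series (fun i => Series (a i))).
    - intros N. rewrite !Hx. apply Series_le; auto. intros i. split; trivial.
      rewrite sum_Sn. unfold plus; simpl. generalize (Ha i (S N)). lra.
    - intros N. rewrite Hx. apply Series_le; auto. }
  destruct L as [l Hl]. now exists l.
Qed.

(** In the divergent case the partial sums are still nonnegative, and [Series] sends an infinite
    limit to 0. *)
Lemma Znorm_ge_0 (g : Z -> C) : 0 <= Znorm g.
Proof.
  destruct (ex_series_dec (Zabs g)) as [H | H].
  - eapply Rle_trans; [apply Cmod_ge_0 | apply (Znorm_ge_term g 0 H)].
  - assert (E : forall N, 0 <= sum_n (Zabs g) N).
    { induction N as [| N IH]; [rewrite sum_O; apply Zabs_ge_0 |].
      rewrite sum_Sn. unfold plus; simpl. generalize (Zabs_ge_0 g (S N)). lra. }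
    unfold Znorm, Series.
    assert (Q : Rbar_le 0 (Lim_seq (sum_n (Zabs g)))).
    { rewrite <- (Lim_seq_const 0). apply Lim_seq_le_loc. exists 0%nat. intros n _. apply E. }
    destruct (Lim_seq (sum_n (Zabs g))); simpl in *; lra.
Qed.

Section Fubini.

Variable f : Z -> Z -> C.
Hypothesis row_summable : forall i, summable (f i).
Hypothesis total_summable : summable (fun i => RtoC (Znorm (f i))).

Lemma column_summable (k : Z) : summable (fun i => f i k).
Proof.
  apply summable_le with 1 (fun i => RtoC (Znorm (f i))); trivial.
  intros i. rewrite Rmult_1_l, Cmod_R, Rabs_pos_eq by apply Znorm_ge_0.
  now apply Znorm_ge_term.
Qed.

(** The four sign quadrants are folded into one nonnegative array [a] over the naturals, to which
    [Series_swap_ex] applies. *)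
Lemma summable_columns : summable (fun k => Zseries (fun i => f i k)).
Proof.
  set (a := fun i k : nat => Zabs (f (Z.of_nat i)) k + Zabs (f (- Z.of_nat (S i))%Z) k).
  destruct (Series_swap_ex a) as [H1 H2].
  - intros i k. unfold a. generalize (Zabs_ge_0 (f (Z.of_nat i)) k) (Zabs_ge_0 (f (- Z.of_nat (S i))%Z) k). lra.
  - intros i. apply (ex_series_plus _ _ (row_summable (Z.of_nat i)) (row_summable (- Z.of_nat (S i))%Z)).
  - revert total_summable. apply ex_series_ext. intros i. unfold a, Zabs at 1.
    rewrite !Cmod_R, !Rabs_pos_eq by apply Znorm_ge_0.
    rewrite Series_plus; trivial; apply row_summable.
  - apply ex_series_ge_0_le with (2 := H2). intros k. split; [apply Zabs_ge_0 |].
    replace (Series (fun i => a i k))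
      with (Znorm (fun i => f i (Z.of_nat k)) + Znorm (fun i => f i (- Z.of_nat (S k))%Z)).
    + unfold Zabs. apply Rplus_le_compat; apply Zseries_Cmod_le, column_summable.
    + unfold Znorm. rewrite <- Series_plus by apply column_summable.
      apply Series_ext. intros i. unfold a, Zabs. ring.
Qed.

Lemma partial_columns (N : nat) :
  summable (fun i => sum_n (G := C_AbelianMonoid) (Zfold (f i)) N) /\
  sum_n (G := C_AbelianMonoid) (Zfold (fun k => Zseries (fun i => f i k))) N
  = Zseries (fun i => sum_n (G := C_AbelianMonoid) (Zfold (f i)) N).
Proof.
  assert (E : forall k, summable (fun i => Zfold (f i) k) /\
     Zfold (fun k => Zseries (fun i => f i k)) k = Zseries (fun i => Zfold (f i) k)).
  { intros k. split.
    - apply summable_plus; apply column_summable.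
    - unfold Zfold. rewrite Zseries_plus by apply column_summable. reflexivity. }
  induction N as [| N [IH1 IH2]].
  - destruct (E 0%nat) as [E1 E2]. split.
    + revert E1. apply summable_ext. intros i. now rewrite sum_O.
    + rewrite sum_O, E2. apply Zseries_ext. intros i. now rewrite sum_O.
  - destruct (E (S N)) as [E1 E2]. split.
    + apply summable_ext with (2 := summable_plus _ _ IH1 E1). intros i. now rewrite sum_Sn.
    + rewrite sum_Sn, IH2, E2. unfold plus; simpl. rewrite <- Zseries_plus by trivial.
      apply Zseries_ext. intros i. now rewrite sum_Sn.
Qed.

(** Finite column sums commute with the sum over i; letting their number grow is dominated
    convergence, with the row norms as majorant. *)
Lemma Zseries_swap :
  Zseries (fun k => Zseries (fun i => f i k)) = Zseries (fun i => Zseries (f i)).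
Proof.
  apply Zseries_fold_eq; [apply summable_columns |]. apply is_Cseries_Clim.
  apply Clim_ext with (fun N => Zseries (fun i => sum_n (G := C_AbelianMonoid) (Zfold (f i)) N)).
  { intros N. symmetry. apply partial_columns. }
  apply Zseries_Tannery with (fun i => RtoC (Znorm (f i))); trivial.
  - intros N i. rewrite Cmod_R, Rabs_pos_eq by apply Znorm_ge_0.
    eapply Rle_trans; [apply (sum_n_Cmod_le _ (Zabs (f i))) |].
    + intros n. apply Cmod_triangle.
    + apply sum_n_le_Series; [apply Zabs_ge_0 | apply row_summable].
  - intros i. apply is_Cseries_Clim, summable_fold, row_summable.
Qed.

End Fubini.

(** * Point masses, regrouping and convolution over Z *)

Lemma sum_n_zero_C (f : nat -> C) (N : nat) :
  (forall n, f n = RtoC 0) -> sum_n (G := C_AbelianMonoid) f N = RtoC 0.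
Proof.
  intros H. induction N as [| N IH]; [rewrite sum_O; apply H |].
  rewrite sum_Sn, IH, H. unfold plus; simpl. ring.
Qed.

Lemma is_Zseries_zero : is_Zseries (fun _ => RtoC 0) 0.
Proof.
  assert (Z0 : is_Cseries (fun _ => RtoC 0) (RtoC 0)).
  { apply is_Cseries_Clim, Clim_ext with (fun _ => RtoC 0); [| apply Clim_const].
    intros N. now rewrite sum_n_zero_C. }
  exists (RtoC 0), (RtoC 0). repeat split; trivial. ring.
Qed.

Lemma summable_zero : summable (fun _ => RtoC 0).
Proof.
  apply summable_is_Zseries. exists (RtoC 0).
  apply is_Zseries_ext with (2 := is_Zseries_zero). intros n. now rewrite Cmod_0.
Qed.

Definition Zdelta (k n : Z) : C := if Z.eq_dec n k then RtoC 1 else RtoC 0.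

Lemma Zdelta_sum (k : Z) : summable (Zdelta k) /\ Zseries (Zdelta k) = RtoC 1.
Proof.
  assert (D0 : is_Zseries (Zdelta 0) 1).
  { exists (RtoC 1), (RtoC 0). repeat split.
    - apply is_series_decr_1.
      change (is_Cseries (fun k => Zdelta 0 (Z.of_nat (S k))) (1 - 1)%C).
      replace (1 - 1)%C with (RtoC 0) by ring.
      apply is_Cseries_Clim, Clim_ext with (fun _ => RtoC 0); [| apply Clim_const].
      intros N. rewrite sum_n_zero_C; trivial.
    - apply is_Cseries_Clim, Clim_ext with (fun _ => RtoC 0); [| apply Clim_const].
      intros N. rewrite sum_n_zero_C; trivial.
    - ring. }
  assert (D : is_Zseries (Zdelta k) 1).
  { apply (is_Zseries_shift (- k)) in D0. revert D0. apply is_Zseries_ext.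
    intros n. unfold Zdelta. do 2 destruct Z.eq_dec; trivial; lia. }
  split.
  - apply summable_is_Zseries. exists (RtoC 1). revert D. apply is_Zseries_ext.
    intros n. unfold Zdelta. destruct Z.eq_dec; [now rewrite Cmod_1 | now rewrite Cmod_0].
  - now apply Zseries_eq.
Qed.

Lemma summable_Cmod (f : Z -> C) : summable f -> summable (fun n => RtoC (Cmod (f n))).
Proof.
  apply summable_le with 1. intros n. rewrite Cmod_R, Rabs_pos_eq by apply Cmod_ge_0. lra.
Qed.

Lemma Znorm_Zseries (f : Z -> C) :
  summable f -> RtoC (Znorm f) = Zseries (fun n => RtoC (Cmod (f n))).
Proof.
  intros Hf. symmetry. apply Zseries_fold_eq; [now apply summable_Cmod |].
  apply is_Cseries_Clim.
  apply Clim_ext with (fun N => RtoC (sum_n (Zabs f) N)).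
  - intros N. induction N as [| N IH].
    + rewrite !sum_O. apply RtoC_plus.
    + rewrite !sum_Sn, <- IH. unfold plus; simpl. rewrite RtoC_plus. f_equal.
      apply RtoC_plus.
  - assert (L : is_lim_seq (sum_n (Zabs f)) (Series (Zabs f))) by apply Series_correct, Hf.
    apply is_lim_seq_spec. intros eps.
    destruct (proj2 (is_lim_seq_spec _ _) L eps) as [N HN].
    exists N. intros n Hn. specialize (HN n Hn).
    now rewrite <- RtoC_minus, Cmod_R, Rminus_0_r, Rabs_Rabsolu.
Qed.

Lemma Znorm_delta (k : Z) (c : C) : Znorm (fun n => c * Zdelta k n)%C = Cmod c.
Proof.
  destruct (Zdelta_sum k) as [Sk E]. apply RtoC_inj.
  rewrite Znorm_Zseries by now apply summable_scal.
  rewrite (Zseries_ext _ (fun n => Cmod c * Zdelta k n)%C).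
  - rewrite Zseries_scal, E by trivial. ring.
  - intros n. unfold Zdelta. rewrite Cmod_mult, RtoC_mult.
    destruct Z.eq_dec; now rewrite ?Cmod_1, ?Cmod_0.
Qed.

Lemma Znorm_shift (k : Z) (f : Z -> C) : summable f -> Znorm (fun n => f (n + k)%Z) = Znorm f.
Proof.
  intros Hf. apply RtoC_inj. rewrite !Znorm_Zseries by (trivial; now apply summable_shift).
  apply (Zseries_shift k (fun n => RtoC (Cmod (f n)))). now apply summable_Cmod.
Qed.

(** Regroups the sum by the value of [e]: the inner series collects all x i with e i = m. Each row
    is a point mass of norm |x i|, which is what the interchange of sums requires. *)
Lemma Zseries_pushforward (x : Z -> C) (e : Z -> Z) :
  summable x ->
  summable (fun m => Zseries (fun i => x i * Zdelta (e i) m)%C) /\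
  Zseries (fun m => Zseries (fun i => x i * Zdelta (e i) m)%C) = Zseries x.
Proof.
  intros Hx.
  assert (R : forall i, summable (fun m => x i * Zdelta (e i) m)%C).
  { intros i. apply summable_scal, Zdelta_sum. }
  assert (T : summable (fun i => RtoC (Znorm (fun m => x i * Zdelta (e i) m)%C))).
  { apply summable_le with 1 x; trivial. intros i.
    rewrite Znorm_delta, Cmod_R, Rabs_pos_eq by apply Cmod_ge_0. lra. }
  split.
  - apply (summable_columns (fun i m => x i * Zdelta (e i) m)%C); trivial.
  - rewrite (Zseries_swap (fun i m => x i * Zdelta (e i) m)%C) by trivial.
    apply Zseries_ext. intros i. rewrite Zseries_scal by apply Zdelta_sum.
    rewrite (proj2 (Zdelta_sum (e i))). ring.
Qed.

Lemma Zseries_support (f : Z -> C) (k : Z) :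
  (forall n, n <> k -> f n = RtoC 0) -> summable f /\ Zseries f = f k.
Proof.
  intros H.
  assert (E : forall n, (f k * Zdelta k n)%C = f n).
  { intros n. unfold Zdelta. destruct (Z.eq_dec n k) as [-> | D]; [ring |].
    rewrite (H n D). ring. }
  destruct (Zdelta_sum k) as [Sk D]. split.
  - apply summable_ext with (1 := E), summable_scal, Sk.
  - rewrite <- (Zseries_ext _ _ E), Zseries_scal, D by trivial. ring.
Qed.

Lemma Zseries_zero (f : Z -> C) : (forall n, f n = RtoC 0) -> Zseries f = RtoC 0.
Proof.
  intros H. rewrite <- (H 0%Z). apply Zseries_support. auto.
Qed.

(** The Cauchy product: row i of the double series has norm |u i| times [Znorm v]. *)
Lemma Zseries_mult (u v : Z -> C) :
  summable u -> summable v ->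
  summable (fun m => Zseries (fun i => u i * v (m - i)%Z)%C) /\
  Zseries (fun m => Zseries (fun i => u i * v (m - i)%Z)%C) = (Zseries u * Zseries v)%C.
Proof.
  intros Hu Hv.
  assert (Hvs : forall i, summable (fun m => v (m - i)%Z)).
  { intros i. apply (summable_shift (- i) v Hv). }
  assert (R : forall i, summable (fun m => u i * v (m - i)%Z)%C).
  { intros i. now apply summable_scal. }
  assert (T : summable (fun i => RtoC (Znorm (fun m => u i * v (m - i)%Z)%C))).
  { apply summable_le with (Znorm v) u; trivial. intros i.
    rewrite Cmod_R, Rabs_pos_eq by apply Znorm_ge_0.
    eapply Rle_trans.
    - apply (Znorm_le (Cmod (u i)) _ (fun m => v (m - i)%Z)); auto.
      intros n. rewrite Cmod_mult. apply Rle_refl.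
    - rewrite (Znorm_shift (- i) v Hv : Znorm (fun m => v (m - i)%Z) = _), Rmult_comm. apply Rle_refl. }
  split.
  - apply (summable_columns (fun i m => u i * v (m - i)%Z)%C); trivial.
  - rewrite (Zseries_swap (fun i m => u i * v (m - i)%Z)%C) by trivial.
    rewrite Cmult_comm, <- Zseries_scal by trivial. apply Zseries_ext. intros i.
    rewrite Zseries_scal by trivial.
    rewrite (Zseries_shift (- i) v Hv : Zseries (fun m => v (m - i)%Z) = _). ring.
Qed.

Lemma Zseries_swap_bounded (u v : Z -> C) (f : Z -> Z -> C) :
  summable u -> summable v -> (forall i k, Cmod (f i k) <= Cmod (u i) * Cmod (v k)) ->
  Zseries (fun k => Zseries (fun i => f i k)) = Zseries (fun i => Zseries (f i)).
Proof.
  intros Hu Hv H. apply Zseries_swap.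
  - intros i. apply summable_le with (Cmod (u i)) v; auto.
  - apply summable_le with (Znorm v) u; trivial. intros i.
    rewrite Cmod_R, Rabs_pos_eq by apply Znorm_ge_0.
    rewrite Rmult_comm. apply Znorm_le; auto.
Qed.

(** * Powers of q and theta coefficients *)

Lemma epow_expand (w : C) (a : R) :
  epow w a = (exp (- (2 * PI * a * Im w)) * cos (2 * PI * a * Re w),
              exp (- (2 * PI * a * Im w)) * sin (2 * PI * a * Re w)).
Proof.
  unfold epow, Cexp. destruct w as [x y]. simpl.
  replace ((2 * PI * a * 0 - 0 * 1) * x - (2 * PI * a * 1 + 0 * 0) * y)
    with (- (2 * PI * a * y)) by ring.
  replace ((2 * PI * a * 0 - 0 * 1) * y + (2 * PI * a * 1 + 0 * 0) * x)
    with (2 * PI * a * x) by ring.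
  reflexivity.
Qed.

Lemma Cmod_epow (w : C) (a : R) : Cmod (epow w a) = exp (- (2 * PI * a * Im w)).
Proof.
  rewrite epow_expand. unfold Cmod. simpl fst. simpl snd.
  set (r := exp _). set (x := 2 * PI * a * Re w).
  replace ((r * cos x) ^ 2 + (r * sin x) ^ 2) with (Rsqr r * (Rsqr (sin x) + Rsqr (cos x)))
    by (unfold Rsqr; ring).
  rewrite sin2_cos2, Rmult_1_r. apply sqrt_Rsqr, Rlt_le, exp_pos.
Qed.

Lemma epow_plus (w : C) (a b : R) : epow w (a + b) = (epow w a * epow w b)%C.
Proof.
  rewrite !epow_expand. unfold Cmult. simpl fst. simpl snd.
  replace (- (2 * PI * (a + b) * Im w)) with (- (2 * PI * a * Im w) + - (2 * PI * b * Im w)) by ring.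
  replace (2 * PI * (a + b) * Re w) with (2 * PI * a * Re w + 2 * PI * b * Re w) by ring.
  rewrite exp_plus, cos_plus, sin_plus. f_equal; ring.
Qed.

Lemma epow_plus_base (w v : C) (a : R) : epow (w + v) a = (epow w a * epow v a)%C.
Proof.
  rewrite !epow_expand. unfold Cmult. destruct w as [x y], v as [x' y']. simpl.
  replace (- (2 * PI * a * (y + y'))) with (- (2 * PI * a * y) + - (2 * PI * a * y')) by ring.
  replace (2 * PI * a * (x + x')) with (2 * PI * a * x + 2 * PI * a * x') by ring.
  rewrite exp_plus, cos_plus, sin_plus. f_equal; ring.
Qed.

Lemma epow_scal_base (c : R) (w : C) (a : R) : epow (c * w) a = epow w (c * a).
Proof.
  rewrite !epow_expand. destruct w as [x y]. simpl.
  f_equal; (f_equal; f_equal; ring).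
Qed.

Lemma epow_0 (w : C) : epow w 0 = RtoC 1.
Proof.
  rewrite epow_expand. rewrite !Rmult_0_r, !Rmult_0_l, Ropp_0, exp_0, cos_0, sin_0.
  unfold RtoC. f_equal; ring.
Qed.

Lemma epow_neq_0 (w : C) (a : R) : epow w a <> RtoC 0.
Proof. apply Cmod_gt_0. rewrite Cmod_epow. apply exp_pos. Qed.

Lemma epow_opp (w : C) (a : R) : epow w (- a) = (/ epow w a)%C.
Proof.
  assert (H : (epow w a * epow w (- a))%C = RtoC 1)
    by (rewrite <- epow_plus, Rplus_opp_r; apply epow_0).
  assert (N := epow_neq_0 w a).
  replace (epow w (- a)) with (/ epow w a * (epow w a * epow w (- a)))%C by (field; trivial).
  rewrite H. ring.
Qed.

Lemma Cpow_epow (w : C) (a : R) (n : nat) : Cpow (epow w a) n = epow w (a * INR n).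
Proof.
  induction n as [| n IH].
  - simpl. now rewrite Rmult_0_r, epow_0.
  - rewrite Cpow_S, IH, <- epow_plus, S_INR. f_equal. ring.
Qed.

Lemma Cpowz_epow (w : C) (a : R) (n : Z) : Cpowz (epow w a) n = epow w (a * n).
Proof.
  destruct n as [| k | k]; unfold Cpowz.
  - now rewrite Rmult_0_r, epow_0.
  - rewrite Cpow_epow, INR_IPR. reflexivity.
  - rewrite Cpow_epow, INR_IPR, <- epow_opp.
    f_equal. change (IZR (Zneg k)) with (- IPR k). ring.
Qed.

Definition sg (n : Z) : C := Cpowz (- (1)) n.

Lemma epow_half : epow 1 (1 / 2) = (- (1))%C.
Proof.
  rewrite epow_expand. simpl.
  replace (2 * PI * (1 / 2) * 0) with 0 by ring. replace (2 * PI * (1 / 2) * 1) with PI by field.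
  rewrite Ropp_0, exp_0, cos_PI, sin_PI. unfold Copp, RtoC. simpl. f_equal; ring.
Qed.

(** With base w = 1, signs become powers e^(pi i n), so that their laws follow from those of
    [epow]. *)
Lemma sg_epow (n : Z) : sg n = epow 1 (n / 2).
Proof. unfold sg. rewrite <- epow_half, Cpowz_epow. f_equal. field. Qed.

Lemma sg_plus (m n : Z) : sg (m + n) = (sg m * sg n)%C.
Proof. rewrite !sg_epow, <- epow_plus, plus_IZR. f_equal. field. Qed.

Lemma Cmod_sg (n : Z) : Cmod (sg n) = 1.
Proof. rewrite sg_epow, Cmod_epow. simpl. rewrite Rmult_0_r, Ropp_0. apply exp_0. Qed.

Lemma sg_1 : sg 1 = (- (1))%C.
Proof. unfold sg, Cpowz. apply Cpow_1_r. Qed.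

Lemma sg_square (n : Z) : (sg n * sg n)%C = RtoC 1.
Proof.
  assert (H : forall k : nat, (sg (Z.of_nat k) * sg (Z.of_nat k))%C = RtoC 1).
  { induction k as [| k IH].
    - unfold sg. simpl. ring.
    - rewrite Nat2Z.inj_succ, <- Z.add_1_r, sg_plus, sg_1.
      replace (sg (Z.of_nat k) * - (1) * (sg (Z.of_nat k) * - (1)))%C
        with (sg (Z.of_nat k) * sg (Z.of_nat k))%C by ring. exact IH. }
  destruct (Z.le_ge_cases 0 n) as [Hn | Hn].
  - rewrite <- (Z2Nat.id n Hn). apply H.
  - assert (S0 : (sg n * sg (- n))%C = RtoC 1).
    { rewrite <- sg_plus, Z.add_opp_diag_r. reflexivity. }
    assert (S1 : (sg (- n) * sg (- n))%C = RtoC 1).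
    { rewrite <- (Z2Nat.id (- n)) by lia. apply H. }
    replace (sg n * sg n)%C with (sg n * sg n * (sg (- n) * sg (- n)))%C by (rewrite S1; ring).
    replace (sg n * sg n * (sg (- n) * sg (- n)))%C
      with ((sg n * sg (- n)) * (sg n * sg (- n)))%C by ring.
    rewrite S0. ring.
Qed.

Lemma sg_opp (n : Z) : sg (- n) = sg n.
Proof.
  assert (S0 : (sg n * sg (- n))%C = RtoC 1).
  { rewrite <- sg_plus, Z.add_opp_diag_r. reflexivity. }
  replace (sg (- n)) with ((sg n * sg n) * sg (- n))%C by (rewrite sg_square; ring).
  replace (sg n * sg n * sg (- n))%C with (sg n * (sg n * sg (- n)))%C by ring.
  rewrite S0. ring.
Qed.

Lemma sg_succ (n : Z) : sg (n + 1) = (- sg n)%C.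
Proof. rewrite sg_plus, sg_1. ring. Qed.

Lemma sg_mul_even (n : Z) : sg (2 * n) = RtoC 1.
Proof. replace (2 * n)%Z with (n + n)%Z by lia. rewrite sg_plus. apply sg_square. Qed.

Lemma Cpowz_opp_epow (w : C) (a : R) (n : Z) : Cpowz (- epow w a) n = (sg n * epow w (a * n))%C.
Proof.
  rewrite <- Cpowz_epow. unfold sg.
  replace (- epow w a)%C with (- (1) * epow w a)%C by ring.
  assert (N := epow_neq_0 w a).
  assert (N1 : (- (1))%C <> RtoC 0).
  { apply Cmod_gt_0. rewrite Cmod_m1. lra. }
  destruct n as [| k | k]; unfold Cpowz.
  - ring.
  - apply Cpow_mult_l.
  - rewrite Cpow_mult_l. field. split; apply Cpow_nz; trivial.
Qed.

Lemma IZR_binom2 (n : Z) : IZR (binom2 n) = n * (n - 1) / 2.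
Proof.
  unfold binom2.
  assert (H : exists k, (n * (n - 1) = k * 2)%Z).
  { destruct (Z.Even_or_Odd n) as [[k ->] | [k ->]].
    - exists (k * (2 * k - 1))%Z. lia.
    - exists ((2 * k + 1) * k)%Z. lia. }
  destruct H as [k Hk]. rewrite Hk, Z.div_mul by lia.
  rewrite <- minus_IZR, <- mult_IZR, Hk, mult_IZR. field.
Qed.

Ltac push_IZR := rewrite ?plus_IZR, ?minus_IZR, ?mult_IZR, ?opp_IZR;
  repeat (rewrite plus_IZR || rewrite minus_IZR || rewrite mult_IZR || rewrite opp_IZR).

Lemma exp_decay_summable (c : R) : 0 < c -> summable (fun n => RtoC (exp (- (c * Rabs n)))).
Proof.
  intros Hc.
  assert (E : forall n, exp (- (c * INR n)) = exp (- c) ^ n).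
  { induction n as [| n IH].
    - simpl. now rewrite Rmult_0_r, Ropp_0, exp_0.
    - rewrite S_INR. simpl pow. rewrite <- IH, <- exp_plus. f_equal. ring. }
  assert (G : ex_series (fun n => exp (- c) ^ n)).
  { apply ex_series_geom. rewrite Rabs_pos_eq by apply Rlt_le, exp_pos.
    rewrite <- exp_0. apply exp_increasing. lra. }
  apply summable_halves. split.
  - revert G. apply ex_series_ext. intros n.
    rewrite Cmod_R, Rabs_pos_eq by apply Rlt_le, exp_pos.
    rewrite <- E, INR_IZR_INZ, Rabs_pos_eq by (apply IZR_le; lia). reflexivity.
  - apply (ex_series_incr_1 (fun n => exp (- c) ^ n)) in G. revert G. apply ex_series_ext. intros n.
    rewrite Cmod_R, Rabs_pos_eq by apply Rlt_le, exp_pos.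
    rewrite <- E, INR_IZR_INZ, opp_IZR, Rabs_Ropp, Rabs_pos_eq by (apply IZR_le; lia). reflexivity.
Qed.

Section Tau.

Variable tau : C.
Hypothesis Htau : 0 < Im tau.

Notation E := (epow tau).

(** The bound M comes from completing the square in T a x^2 - L x. The 2 in [L] pays once for 1 +
    |n| <= e^|n| and once for the decay e^(-|n|) on the right. The weight 1 + |n| serves plain sums
    and sums with a factor n alike. *)
Lemma gauss_bound (a b c : R) : 0 < a ->
  exists M, forall n : Z, (1 + Rabs n) * Cmod (E (a * n ^ 2 + b * n + c)) <= M * exp (- (1 * Rabs n)).
Proof.
  intros Ha. set (T := 2 * PI * Im tau).
  assert (HT : 0 < T) by (unfold T; apply Rmult_lt_0_compat; trivial; generalize PI_RGT_0; lra).
  set (L := T * Rabs b + 2).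
  exists (exp (L ^ 2 / (4 * (T * a)) - T * c)). intros n.
  rewrite Cmod_epow.
  set (x := Rabs n). assert (Hx : 0 <= x) by apply Rabs_pos.
  assert (Hx2 : n ^ 2 = x ^ 2) by (unfold x; now rewrite pow2_abs).
  assert (Hb : - (Rabs b * x) <= b * n).
  { unfold x. rewrite <- Rabs_mult. generalize (Rle_abs (- (b * n))). rewrite Rabs_Ropp. lra. }
  apply Rle_trans with (exp x * exp (- (2 * PI * (a * n ^ 2 + b * n + c) * Im tau))).
  - apply Rmult_le_compat_r; [apply Rlt_le, exp_pos |]. apply exp_ineq1_le.
  - rewrite <- !exp_plus.
    assert (Q : x + - (2 * PI * (a * n ^ 2 + b * n + c) * Im tau)
            <= L ^ 2 / (4 * (T * a)) - T * c + - (1 * x));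
      [| destruct Q as [Q | ->]; [apply Rlt_le, exp_increasing, Q | apply Rle_refl]].
    replace (2 * PI * (a * n ^ 2 + b * n + c) * Im tau) with (T * (a * n ^ 2 + b * n + c))
      by (unfold T; ring).
    rewrite Hx2.
    assert (P : T * - (Rabs b * x) <= T * (b * n)) by (apply Rmult_le_compat_l; lra).
    assert (Sq : 0 <= L ^ 2 / (4 * (T * a)) - L * x + T * a * x ^ 2).
    { assert (HTa : 0 < T * a) by now apply Rmult_lt_0_compat.
      replace (L ^ 2 / (4 * (T * a)) - L * x + T * a * x ^ 2)
        with ((L / 2 - T * a * x) ^ 2 / (T * a)) by (field; lra).
      apply Rmult_le_pos; [apply pow2_ge_0 |]. apply Rlt_le, Rinv_0_lt_compat, HTa. }
    unfold L in Sq at 2. lra.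
Qed.

Lemma gauss_weighted (a b c : R) : 0 < a ->
  summable (fun n : Z => n * E (a * n ^ 2 + b * n + c))%C.
Proof.
  intros Ha. destruct (gauss_bound a b c Ha) as [M HM].
  apply summable_le with M (fun n : Z => RtoC (exp (- (1 * Rabs n)))); [| apply exp_decay_summable, Rlt_0_1].
  intros n. rewrite Cmod_mult, !Cmod_R, (Rabs_pos_eq (exp _)) by apply Rlt_le, exp_pos.
  eapply Rle_trans; [| apply HM]. apply Rmult_le_compat_r; [apply Cmod_ge_0 |]. lra.
Qed.

Lemma gauss_summable (a b c : R) : 0 < a ->
  summable (fun n : Z => E (a * n ^ 2 + b * n + c)).
Proof.
  intros Ha. destruct (gauss_bound a b c Ha) as [M HM].
  apply summable_le with M (fun n : Z => RtoC (exp (- (1 * Rabs n)))); [| apply exp_decay_summable, Rlt_0_1].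
  intros n. rewrite Cmod_R, (Rabs_pos_eq (exp _)) by apply Rlt_le, exp_pos.
  eapply Rle_trans; [| apply HM].
  generalize (Rmult_le_pos _ _ (Rabs_pos n) (Cmod_ge_0 (E (a * n ^ 2 + b * n + c)))). lra.
Qed.

Lemma Cmod_epow_le (a b : R) : a <= b -> Cmod (E b) <= Cmod (E a).
Proof.
  intros H. rewrite !Cmod_epow.
  assert (Q : 2 * PI * a * Im tau <= 2 * PI * b * Im tau).
  { apply Rmult_le_compat_r; [lra |]. apply Rmult_le_compat_l; trivial. generalize PI_RGT_0. lra. }
  destruct (Rle_lt_or_eq_dec _ _ Q) as [Q' | ->]; [| lra].
  apply Rlt_le, exp_increasing. lra.
Qed.

Lemma Cmod_epow_lt (a b : R) : a < b -> Cmod (E b) < Cmod (E a).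
Proof.
  intros H. rewrite !Cmod_epow. apply exp_increasing, Ropp_lt_contravar.
  apply Rmult_lt_compat_r; trivial. apply Rmult_lt_compat_l; trivial. generalize PI_RGT_0. lra.
Qed.

(** The modulus of q^a is strictly decreasing in a, hence differs from 1 off a = 0. *)
Lemma one_minus_epow_neq_0 (a : R) : a <> 0 -> (1 - E a)%C <> RtoC 0.
Proof.
  intros Ha H. assert (H' : E a = RtoC 1).
  { replace (E a) with (1 - (1 - E a))%C by ring. rewrite H. ring. }
  assert (L : Cmod (E a) = 1) by (rewrite H'; apply Cmod_1).
  destruct (Rtotal_order a 0) as [Q | [Q | Q]]; [| exact (Ha Q) |];
    apply Cmod_epow_lt in Q; rewrite (epow_0 tau), Cmod_1 in Q; lra.
Qed.

Definition theta_coef (n : Z) : C := (sg n * E (n * (n - 1) / 2))%C.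

Lemma theta_coef_summable : summable theta_coef.
Proof.
  apply summable_le with 1 (fun n : Z => E (1 / 2 * n ^ 2 + - (1 / 2) * n + 0)).
  - intros n. unfold theta_coef. rewrite Cmod_mult, Cmod_sg.
    replace (n * (n - 1) / 2) with (1 / 2 * n ^ 2 + - (1 / 2) * n + 0) by field. lra.
  - apply gauss_summable. lra.
Qed.

Lemma theta_coef_succ (n : Z) : theta_coef (n + 1) = (- (theta_coef n * E n))%C.
Proof.
  unfold theta_coef. rewrite sg_succ.
  replace ((n + 1)%Z * ((n + 1)%Z - 1) / 2) with (n * (n - 1) / 2 + n)
    by (push_IZR; field).
  rewrite epow_plus. ring.
Qed.

(** The coefficients are odd under n -> 1 - n; this is j(1; q) = 0. *)
Lemma Zseries_theta_coef : Zseries theta_coef = RtoC 0.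
Proof.
  assert (H : Zseries theta_coef = (- Zseries theta_coef)%C).
  { rewrite <- (Zseries_opp_index _ theta_coef_summable) at 1.
    rewrite <- (Zseries_shift (-1) (fun n => theta_coef (- n)))
      by apply (summable_opp_index _ theta_coef_summable).
    rewrite (Zseries_ext _ (fun n => - (1) * theta_coef n)%C).
    - rewrite Zseries_scal by apply theta_coef_summable. ring.
    - intros n. unfold theta_coef.
      replace (- (n + -1))%Z with (- n + 1)%Z by lia. rewrite sg_succ, sg_opp.
      replace ((- n + 1)%Z * ((- n + 1)%Z - 1) / 2) with (n * (n - 1) / 2)
        by (push_IZR; field).
      ring. }
  assert (K : (2 * Zseries theta_coef)%C = RtoC 0).
  { replace (2 * Zseries theta_coef)%C with (Zseries theta_coef + Zseries theta_coef)%C by ring.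
    rewrite H at 1. ring. }
  replace (Zseries theta_coef) with (/ 2 * (2 * Zseries theta_coef))%C; [rewrite K; ring | field].
Qed.

(** * Partial theta series and the coefficients of the reciprocal of theta *)

Definition partial_theta (k : Z) : C :=
  Zseries (fun n => if (0 <=? n)%Z then sg n * E (n * (n + 1) / 2 + n * k) else 0)%C.

Lemma partial_theta_summable (k : Z) :
  summable (fun n => if (0 <=? n)%Z then sg n * E (n * (n + 1) / 2 + n * k) else 0)%C.
Proof.
  apply summable_le with 1 (fun n : Z => E (1 / 2 * n ^ 2 + (1 / 2 + k) * n + 0)).
  - intros n.
    replace (1 / 2 * n ^ 2 + (1 / 2 + k) * n + 0) with (n * (n + 1) / 2 + n * k) by field.
    destruct (0 <=? n)%Z.
    + rewrite Cmod_mult, Cmod_sg. lra.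
    + rewrite Cmod_0. generalize (Cmod_ge_0 (E (n * (n + 1) / 2 + n * k))). lra.
  - apply gauss_summable. lra.
Qed.

Lemma partial_theta_rec (k : Z) :
  (partial_theta k + E (k + 1) * partial_theta (k + 1))%C = RtoC 1.
Proof.
  unfold partial_theta at 2. rewrite <- Zseries_scal by apply partial_theta_summable.
  set (y := fun n : Z => (if (0 <=? n)%Z then sg n * E (n * (n + 1) / 2 + n * k) else 0)%C).
  assert (Hy : summable y) by apply partial_theta_summable.
  (* After the unit shift the term of [y] at 0, which is 1, sits at n = -1, where the left side has
     no term; the point mass makes up for it. *)
  rewrite (Zseries_ext _ (fun n => Zdelta (-1) n - y (n + 1)%Z)%C).
  - rewrite Zseries_minus by (apply Zdelta_sum || apply (summable_shift 1 y Hy)).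
    rewrite (proj2 (Zdelta_sum _)), (Zseries_shift 1 y Hy). unfold partial_theta. fold y. ring.
  - intros n. unfold y, Zdelta.
    destruct (Z.eq_dec n (-1)) as [-> | D].
    + simpl. replace (0 * (0 + 1) / 2 + 0 * k) with 0 by field. rewrite epow_0.
      unfold sg. simpl. ring.
    + destruct (Z.leb_spec 0 n); destruct (Z.leb_spec 0 (n + 1)); try lia; [| ring].
      rewrite sg_succ.
      replace ((n + 1)%Z * ((n + 1)%Z + 1) / 2 + (n + 1)%Z * k)
        with ((k + 1) + (n * (n + 1) / 2 + n * (k + 1)%Z)) by (push_IZR; field).
      rewrite (epow_plus _ (k + 1)). ring.
Qed.

(* The reflection g_(-k) = q^k g_k is what makes the coefficients bounded for k < 0, where the
   series [partial_theta k] itself is unwieldy, while preserving the recursion. *)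
Definition recip_coef (k : Z) : C :=
  if (0 <=? k)%Z then partial_theta k else (E (- k) * partial_theta (- k))%C.

(** For k < 0 the reflection turns this into the recursion of [partial_theta] at -k - 1 with its two
    terms exchanged; k = -1 is the one value where the two branches of the definition meet. *)
Lemma recip_coef_rec (k : Z) : (recip_coef k + E (k + 1) * recip_coef (k + 1))%C = RtoC 1.
Proof.
  unfold recip_coef. destruct (Z.leb_spec 0 k); destruct (Z.leb_spec 0 (k + 1)); try lia.
  - apply partial_theta_rec.
  - replace k with (-1)%Z by lia. simpl.
    rewrite <- (partial_theta_rec 0). simpl.
    replace (-1 + 1) with 0 by ring. replace (0 + 1) with 1 by ring.
    replace (- -1) with 1 by ring.
    rewrite epow_0. ring.
  - rewrite <- (partial_theta_rec (- k - 1)).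
    replace (- k - 1 + 1)%Z with (- k)%Z by lia. replace (- (k + 1))%Z with (- k - 1)%Z by lia.
    rewrite Cmult_assoc, <- epow_plus. push_IZR.
    replace (- k - 1 + 1) with (- k) by ring. replace (k + 1 + - (k + 1)) with 0 by ring.
    rewrite epow_0. ring.
Qed.

(** The first bound controls k -> +oo, the second gives decay like |q|^|k| as k -> -oo; together
    they yield convergence for |q| < |z| < 1. *)
Lemma recip_coef_bound :
  exists M, 0 <= M /\ forall k, Cmod (recip_coef k) <= M /\ Cmod (recip_coef k) <= M * Cmod (E (- k)).
Proof.
  set (u := fun n : Z => E (1 / 2 * n ^ 2 + 1 / 2 * n + 0)).
  assert (Hu : summable u) by (apply gauss_summable; lra).
  exists (Znorm u). split; [apply Znorm_ge_0 |].
  assert (B : forall k, (0 <= k)%Z -> Cmod (partial_theta k) <= Znorm u).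
  { intros k Hk. eapply Rle_trans; [apply Zseries_Cmod_le, partial_theta_summable |].
    rewrite <- (Rmult_1_l (Znorm u)). apply Znorm_le; trivial. intros n. rewrite Rmult_1_l.
    destruct (Z.leb_spec 0 n).
    - rewrite Cmod_mult, Cmod_sg, Rmult_1_l. unfold u. apply Cmod_epow_le.
      assert (0 <= n * k) by (apply Rmult_le_pos; now apply IZR_le). nra.
    - rewrite Cmod_0. apply Cmod_ge_0. }
  intros k. unfold recip_coef. destruct (Z.leb_spec 0 k) as [Hk | Hk].
  - specialize (B k Hk). split; trivial.
    assert (L : 1 <= Cmod (E (- k))).
    { rewrite <- Cmod_1, <- (epow_0 tau). apply Cmod_epow_le. apply IZR_le in Hk. lra. }
    generalize (Znorm_ge_0 u). nra.
  - specialize (B (- k)%Z ltac:(lia)). rewrite Cmod_mult.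
    assert (L : Cmod (E (- k)) <= 1).
    { rewrite <- Cmod_1, <- (epow_0 tau). apply Cmod_epow_le. apply IZR_lt in Hk. lra. }
    generalize (Cmod_ge_0 (E (- k))) (Znorm_ge_0 u) (Cmod_ge_0 (partial_theta (- k))). intros. split; nra.
Qed.

(** By the recursion g_k - 1 = -q^(k+1) g_(k+1). The limit 1 at +oo is the trace of the pole at z =
    1. *)
Lemma recip_coef_minus_1_bound :
  exists M, 0 <= M /\ forall k : Z, Cmod (recip_coef k - 1) <= M * Cmod (E k).
Proof.
  destruct recip_coef_bound as [M [HM B]].
  exists (Cmod (E 1) * M). split; [apply Rmult_le_pos; trivial; apply Cmod_ge_0 |].
  intros k.
  replace (recip_coef k - 1)%C with (- (E (k + 1) * recip_coef (k + 1)))%C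
    by (rewrite <- (recip_coef_rec k); ring).
  rewrite Cmod_opp, epow_plus, !Cmod_mult.
  destruct (B (k + 1)%Z) as [B1 _].
  generalize (Cmod_ge_0 (E k)) (Cmod_ge_0 (E 1)). intros.
  replace (Cmod (E 1) * M * Cmod (E k)) with (Cmod (E k) * Cmod (E 1) * M) by ring.
  apply Rmult_le_compat_l; trivial. now apply Rmult_le_pos.
Qed.

Lemma theta_recip_summable (m : Z) : summable (fun i => theta_coef i * recip_coef (m - i))%C.
Proof.
  destruct recip_coef_bound as [M [HM B]].
  apply summable_le with M theta_coef; [| apply theta_coef_summable].
  intros i. rewrite Cmod_mult, Rmult_comm. apply Rmult_le_compat_r; [apply Cmod_ge_0 | apply B].
Qed.

(** Multiply the recursion at m - i by theta_i and sum over i. Since theta_i q^(m-i+1) = -q^m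
    theta_(i-1), the result is (1 - q^m) e = j(1; q) = 0. *)
Lemma theta_recip_off_diagonal (m : Z) : m <> 0%Z ->
  Zseries (fun i => theta_coef i * recip_coef (m - i))%C = RtoC 0.
Proof.
  intros Hm. set (e := Zseries _).
  assert (Q : (e + - (E m * e))%C = RtoC 0).
  { rewrite <- Zseries_theta_coef. unfold e at 2.
    rewrite <- Zseries_scal by apply theta_recip_summable.
    set (f := fun i => (E m * (theta_coef i * recip_coef (m - i)))%C).
    assert (Hf : summable f) by (apply summable_scal, theta_recip_summable).
    rewrite <- (Zseries_shift (-1) f Hf). unfold e.
    assert (Hf' := summable_shift (-1) f Hf).
    replace (- Zseries (fun n => f (n + -1)%Z))%C with (Zseries (fun n => - (1) * f (n + -1)%Z)%C)
      by (rewrite (Zseries_scal _ _ Hf'); ring).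
    rewrite <- Zseries_plus by (apply theta_recip_summable || now apply summable_scal).
    apply Zseries_ext. intros i. unfold f.
    replace (m - (i + -1))%Z with (m - i + 1)%Z by lia.
    replace (i + -1)%Z with (i - 1)%Z by lia.
    assert (Ht := theta_coef_succ (i - 1)). rewrite Z.sub_add in Ht.
    assert (HE : E m = (E (i - 1)%Z * E ((m - i)%Z + 1))%C)
      by (rewrite <- epow_plus; f_equal; push_IZR; ring).
    transitivity (theta_coef i * (recip_coef (m - i) + E ((m - i)%Z + 1) * recip_coef (m - i + 1)))%C;
      [rewrite HE, Ht; ring | rewrite recip_coef_rec; ring]. }
  assert (N : (1 - E m)%C <> RtoC 0) by (apply one_minus_epow_neq_0; now apply not_0_IZR).
  replace e with (/ (1 - E m) * (e + - (E m * e)))%C by (field; trivial).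
  rewrite Q. ring.
Qed.

(* Abel summation: the terms [theta_coef i * recip_coef (- i)] are the partial sums of [theta_coef]. *)
Lemma theta_recip_diagonal :
  Zseries (fun i => theta_coef i * recip_coef (- i))%C
  = (- Zseries (fun i => i * theta_coef i))%C.
Proof.
  set (T := fun i => (theta_coef i * recip_coef (- i))%C).
  assert (HT : summable T) by apply (theta_recip_summable 0).
  assert (Hw : summable (fun i : Z => i * theta_coef i)%C).
  { apply summable_le with 1 (fun n : Z => n * E (1 / 2 * n ^ 2 + - (1 / 2) * n + 0))%C.
    - intros n. unfold theta_coef. rewrite !Cmod_mult, Cmod_sg.
      replace (n * (n - 1) / 2) with (1 / 2 * n ^ 2 + - (1 / 2) * n + 0) by field. lra.
    - apply gauss_weighted. lra. }
  assert (HiT : summable (fun i : Z => i * T i)%C).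
  { destruct recip_coef_bound as [M [HM B]].
    apply summable_le with M (fun n : Z => n * E (1 / 2 * n ^ 2 + 1 / 2 * n + 0))%C.
    - intros n. unfold T, theta_coef. rewrite !Cmod_mult, Cmod_sg.
      replace (1 / 2 * n ^ 2 + 1 / 2 * n + 0) with (n * (n - 1) / 2 + n) by field.
      rewrite epow_plus, Cmod_mult. destruct (B (- n)%Z) as [_ B2].
      rewrite opp_IZR, Ropp_involutive in B2.
      replace (M * (Cmod n * (Cmod (E (n * (n - 1) / 2)) * Cmod (E n))))
        with (Cmod n * (1 * Cmod (E (n * (n - 1) / 2)) * (M * Cmod (E n)))) by ring.
      apply Rmult_le_compat_l; [apply Cmod_ge_0 |]. apply Rmult_le_compat_l; trivial.
      rewrite Rmult_1_l. apply Cmod_ge_0.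
    - apply gauss_weighted. lra. }
  assert (HT' : forall i, T (i + 1)%Z = (T i + theta_coef (i + 1))%C).
  { intros i. unfold T. rewrite theta_coef_succ.
    assert (R1 := recip_coef_rec (- (i + 1))).
    replace (- (i + 1) + 1)%Z with (- i)%Z in R1 by lia.
    replace ((- (i + 1))%Z + 1) with (- i) in R1 by (push_IZR; ring).
    replace (recip_coef (- (i + 1))) with (1 - E (- i) * recip_coef (- i))%C
      by (rewrite <- R1; ring).
    rewrite epow_opp. field. apply epow_neq_0. }
  (* The summand is (i + 1) T(i + 1) - i T(i), a difference of two shifts of one summable family. *)
  assert (A : (Zseries (fun i => T i + (i + 1)%Z * theta_coef (i + 1)))%C = RtoC 0).
  { rewrite (Zseries_ext _ (fun i => (i + 1)%Z * T (i + 1)%Z - i * T i)%C).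
    - rewrite Zseries_minus; trivial.
      + rewrite (Zseries_shift 1 (fun i : Z => i * T i)%C HiT). ring.
      + apply (summable_shift 1 (fun i : Z => i * T i)%C HiT).
    - intros i. rewrite HT', plus_IZR, RtoC_plus. ring. }
  rewrite Zseries_plus, (Zseries_shift 1 (fun i : Z => i * theta_coef i)%C Hw) in A; trivial.
  - replace (Zseries T) with (Zseries T + Zseries (fun i : Z => i * theta_coef i)
      - Zseries (fun i : Z => i * theta_coef i))%C by ring.
    rewrite A. ring.
  - apply (summable_shift 1 (fun i : Z => i * theta_coef i)%C Hw).
Qed.

End Tau.

(** * Jacobi's identity for (q)_oo^3 *)

Section Jacobi.

Variable tau : C.
Hypothesis Htau : 0 < Im tau.

Notation E := (epow tau).
Notation P := (qpoch (epow tau 1)).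

Lemma qpoch_S (n : nat) : P (S n) = (P n * (1 - E (Z.of_nat n + 1)))%C.
Proof.
  change (P (S n)) with (P n * (1 - Cpow (E 1) (S n)))%C.
  rewrite Cpow_epow, S_INR, INR_IZR_INZ, Rmult_1_l. reflexivity.
Qed.

Lemma Cmod_nome_lt_1 : Cmod (E 1) < 1.
Proof.
  generalize (Cmod_epow_lt tau Htau 0 1 Rlt_0_1). now rewrite epow_0, Cmod_1.
Qed.

(** With x = |q|, [s n] is the geometric sum x + ... + x^n. The factors obey 1 + y <= e^y and, for 0
    < y <= x, 1 - y >= exp(-y / (1 - x)), the latter from 1 / (1 - y) = 1 + y / (1 - y) <= 1 + y /
    (1 - x). The lower bound is what keeps (q)_oo away from 0. *)
Lemma qpoch_bounds :
  exists c M, 0 < c /\ forall n, c <= Cmod (P n) <= M.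
Proof.
  set (x := Cmod (E 1)).
  assert (Hx0 : 0 < x) by (apply Cmod_gt_0, epow_neq_0).
  assert (Hx1 : x < 1) by apply Cmod_nome_lt_1.
  set (s := fun n : nat => x * (1 - x ^ n) / (1 - x)).
  assert (Hs : forall n, 0 <= s n <= 1 / (1 - x)).
  { intros n. assert (0 < x ^ n) by now apply pow_lt.
    assert (x ^ n <= 1) by (rewrite <- (pow1 n); apply pow_incr; lra).
    unfold s. split.
    - apply Rmult_le_pos; [nra |]. apply Rlt_le, Rinv_0_lt_compat. lra.
    - apply Rmult_le_compat_r; [apply Rlt_le, Rinv_0_lt_compat; lra | nra]. }
  assert (HsS : forall n, s (S n) = s n + x ^ S n).
  { intros n. unfold s. simpl. field. lra. }
  assert (Hfac : forall n, 1 - x ^ S n <= Cmod (1 - Cpow (E 1) (S n)) <= 1 + x ^ S n).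
  { intros n. unfold x. rewrite <- Cmod_pow. split.
    - generalize (Cmod_triangle (1 - Cpow (E 1) (S n)) (Cpow (E 1) (S n))).
      replace (1 - Cpow (E 1) (S n) + Cpow (E 1) (S n))%C with (RtoC 1) by ring.
      rewrite Cmod_1. lra.
    - eapply Rle_trans; [apply Cmod_triangle |]. rewrite Cmod_opp, Cmod_1. lra. }
  assert (HxS : forall n, 0 < x ^ S n <= x).
  { intros n. split; [now apply pow_lt |]. simpl.
    assert (x ^ n <= 1) by (rewrite <- (pow1 n); apply pow_incr; lra). nra. }
  assert (B : forall n, exp (- (s n / (1 - x))) <= Cmod (P n) <= exp (s n)).
  { induction n as [| n IH].
    - simpl. rewrite Cmod_1. unfold s. simpl.
      replace (x * (1 - 1) / (1 - x)) with 0 by (field; lra).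
      unfold Rdiv. rewrite Rmult_0_l, Ropp_0, exp_0. lra.
    - change (P (S n)) with (P n * (1 - Cpow (E 1) (S n)))%C.
      rewrite Cmod_mult, HsS. specialize (Hfac n). specialize (HxS n).
      replace (- ((s n + x ^ S n) / (1 - x))) with (- (s n / (1 - x)) + - (x ^ S n / (1 - x)))
        by (field; lra).
      rewrite !exp_plus. set (y := x ^ S n) in *.
      assert (Hy : exp (- (y / (1 - x))) <= 1 - y).
      { rewrite exp_Ropp. rewrite <- (Rinv_inv (1 - y)). apply Rinv_le_contravar.
        - apply Rinv_0_lt_compat. lra.
        - apply Rle_trans with (1 + y / (1 - x)); [| apply exp_ineq1_le].
          apply Rle_trans with (1 + y / (1 - y)).
          + right. field. lra.
          + apply Rplus_le_compat_l, Rmult_le_compat_l; [lra |].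
            apply Rinv_le_contravar; lra. }
      assert (Hy' := exp_ineq1_le y).
      assert (0 < exp (- (s n / (1 - x)))) by apply exp_pos.
      assert (0 < exp (- (y / (1 - x)))) by apply exp_pos.
      split; apply Rmult_le_compat; lra. }
  exists (exp (- (1 / (1 - x) / (1 - x)))), (exp (1 / (1 - x))).
  split; [apply exp_pos |]. intros n. specialize (B n). specialize (Hs n).
  assert (Mono : forall a b, a <= b -> exp a <= exp b).
  { intros a b [H | ->]; [apply Rlt_le, exp_increasing, H | lra]. }
  split.
  - eapply Rle_trans; [| apply B]. apply Mono, Ropp_le_contravar.
    apply Rmult_le_compat_r; [apply Rlt_le, Rinv_0_lt_compat; lra | lra].
  - eapply Rle_trans; [apply B |]. now apply Mono.
Qed.

Lemma qpoch_neq_0 (n : nat) : P n <> RtoC 0.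
Proof.
  destruct qpoch_bounds as [c [M [Hc B]]]. apply Cmod_gt_0. specialize (B n). lra.
Qed.

(** The increments -(q)_n q^(n+1) are dominated by a geometric series. *)
Lemma qpoch_inf_lim : Clim P (qpoch_inf (E 1)).
Proof.
  destruct qpoch_bounds as [c [M [Hc B]]].
  set (d := fun n => (P (S n) - P n)%C).
  destruct (ex_Cseries_abs d) as [l Hl].
  - apply ex_series_ge_0_le with (fun n => M * Cmod (E 1) * Cmod (E 1) ^ n).
    + intros n. split; [apply Cmod_ge_0 |].
      replace (d n) with (- (P n * Cpow (E 1) (S n)))%C by (unfold d; simpl; ring).
      rewrite Cmod_opp, Cmod_mult, Cmod_pow. simpl. rewrite Rmult_assoc.
      apply Rmult_le_compat_r; [| apply B].
      apply Rmult_le_pos; [apply Cmod_ge_0 | apply pow_le, Cmod_ge_0].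
    + apply (ex_series_scal (V := R_NormedModule) (M * Cmod (E 1))), ex_series_geom.
      rewrite Rabs_pos_eq by apply Cmod_ge_0.
      apply Cmod_nome_lt_1.
  - apply is_Cseries_Clim in Hl.
    assert (L : Clim P (1 + l)%C).
    { apply is_lim_seq_incr_1.
      apply (Clim_ext (fun n => 1 + sum_n (G := C_AbelianMonoid) d n)%C).
      - induction n as [| n IH].
        + rewrite sum_O. unfold d. simpl. ring.
        + rewrite sum_Sn. unfold plus; simpl.
          rewrite Cplus_assoc, IH. unfold d. simpl. ring.
      - apply Clim_plus; trivial. apply Clim_const. }
    assert (Q : qpoch_inf (E 1) = (1 + l)%C).
    { apply (iota_unique (V := C_CompleteNormedModule)).
      - intros y Hy. apply filterlim_Clim in Hy. exact (Clim_unique _ _ _ Hy L).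
      - now apply filterlim_Clim. }
    now rewrite Q.
Qed.

Lemma qpoch_inf_neq_0 : qpoch_inf (E 1) <> RtoC 0.
Proof.
  intros H. destruct qpoch_bounds as [c [M [Hc B]]].
  assert (L := qpoch_inf_lim). rewrite H in L.
  assert (Q : Rbar_le c 0); [| simpl in Q; lra].
  apply is_lim_seq_le with (fun _ => c) (fun n => Cmod (P n - 0)).
  - intros n. replace (P n - 0)%C with (P n) by ring. apply B.
  - apply is_lim_seq_const.
  - exact L.
Qed.

(* The convention [1 / (q)_n = 0] for n < 0 makes the recursion below hold for every n. *)
Definition inv_qpoch (n : Z) : C := if (0 <=? n)%Z then (/ P (Z.to_nat n))%C else RtoC 0.

Lemma inv_qpoch_pred (n : Z) : inv_qpoch (n - 1) = ((1 - E n) * inv_qpoch n)%C.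
Proof.
  unfold inv_qpoch. destruct (Z.leb_spec 0 n); destruct (Z.leb_spec 0 (n - 1)); try lia.
  - replace (Z.to_nat n) with (S (Z.to_nat (n - 1))) by lia. rewrite qpoch_S.
    rewrite Z2Nat.id by lia. rewrite minus_IZR. replace (n - 1 + 1) with (IZR n) by ring.
    assert (N := qpoch_neq_0 (Z.to_nat (n - 1))).
    field. split; trivial. apply one_minus_epow_neq_0; trivial. apply not_0_IZR. lia.
  - replace n with 0%Z by lia. rewrite epow_0. ring.
  - ring.
Qed.

Lemma inv_qpoch_bound : exists M, 0 <= M /\ forall n, Cmod (inv_qpoch n) <= M.
Proof.
  destruct qpoch_bounds as [c [M [Hc B]]]. exists (/ c).
  assert (0 < / c) by now apply Rinv_0_lt_compat.
  split; [lra |]. intros n. unfold inv_qpoch. destruct (0 <=? n)%Z.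
  - rewrite Cmod_inv by apply qpoch_neq_0. apply Rinv_le_contravar; trivial. apply B.
  - rewrite Cmod_0. lra.
Qed.

Lemma inv_qpoch_lim (k : Z) :
  Clim (fun N => inv_qpoch (Z.of_nat N + k)) (/ qpoch_inf (E 1))%C.
Proof.
  destruct qpoch_bounds as [c [M [Hc B]]].
  set (L := qpoch_inf (E 1)). assert (HL : L <> RtoC 0) by apply qpoch_inf_neq_0.
  assert (HL' : 0 < Cmod L) by now apply Cmod_gt_0.
  assert (H : Clim (fun n => / P n)%C (/ L)%C).
  { unfold Clim. apply is_lim_seq_le_le with (fun _ => 0) (fun n => / (c * Cmod L) * Cmod (P n - L)).
    - intros n. split; [apply Cmod_ge_0 |]. assert (N := qpoch_neq_0 n).
      replace (/ P n - / L)%C with (/ (P n * L) * - (P n - L))%C by (field; auto).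
      rewrite Cmod_mult, Cmod_opp, Cmod_inv, Cmod_mult.
      2: { intros Q.
           assert (Cmod (P n * L) = 0) by (rewrite Q; apply Cmod_0).
           rewrite Cmod_mult in H. apply Rmult_integral in H.
           generalize (B n). intros. destruct H; lra. }
      apply Rmult_le_compat_r; [apply Cmod_ge_0 |].
      apply Rinv_le_contravar; [now apply Rmult_lt_0_compat |].
      apply Rmult_le_compat_r; [lra | apply B].
    - apply is_lim_seq_const.
    - replace (Finite 0) with (Rbar_mult (/ (c * Cmod L)) 0) by (simpl; f_equal; ring).
      apply is_lim_seq_scal_l. apply qpoch_inf_lim. }
  apply (is_lim_seq_incr_n _ (Z.to_nat (- k))).
  destruct (Z.le_ge_cases 0 k) as [Hk | Hk].
  - replace (Z.to_nat (- k)) with 0%nat by lia.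
    apply (is_lim_seq_incr_n _ (Z.to_nat k)) in H. revert H. apply Clim_ext. intros n.
    unfold inv_qpoch. destruct (Z.leb_spec 0 (Z.of_nat (n + 0) + k)); [| lia].
    f_equal. f_equal. lia.
  - revert H. apply Clim_ext. intros n.
    unfold inv_qpoch. destruct (Z.leb_spec 0 (Z.of_nat (n + Z.to_nat (- k)) + k)); [| lia].
    f_equal. f_equal. lia.
Qed.

(** * Truncated theta sums *)

(** The factors 1 / (q)_(a+n) and 1 / (q)_(c-n) restrict n to -a <= n <= c. For f = 1 this is the
    finite triple product at z = 1, for f(n) = n its derivative there; as a, c -> oo it tends to the
    full theta sum over (q)_oo^2. *)
Definition finite_theta (f : Z -> C) (a c : Z) : C :=
  Zseries (fun n => f n * theta_coef tau n * inv_qpoch (a + n) * inv_qpoch (c - n))%C.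

Lemma finite_theta_summable (f : Z -> C) (a c : Z) :
  summable (fun n => f n * theta_coef tau n)%C ->
  summable (fun n => f n * theta_coef tau n * inv_qpoch (a + n) * inv_qpoch (c - n))%C.
Proof.
  destruct inv_qpoch_bound as [M [HM B]]. apply summable_le with (M * M).
  intros n. rewrite Rmult_comm, 2!(Cmod_mult (_ * _)), Rmult_assoc.
  apply Rmult_le_compat_l; [apply Cmod_ge_0 |].
  apply Rmult_le_compat; trivial; apply Cmod_ge_0.
Qed.

Lemma E_Zplus (a b : Z) : E (a + b)%Z = (E a * E b)%C.
Proof. rewrite plus_IZR. apply epow_plus. Qed.

(** A q-Pascal rule: split 1 - q^(a+c) as (1 - q^(a+n)) + q^(a+n) (1 - q^(c-n)). Either parenthesis
    lowers one index of the window by [inv_qpoch_pred]; a shift of n by one brings the second piece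
    to the window (a - 1, c). *)
Lemma finite_theta_rec_l (f : Z -> C) (a c : Z) :
  summable (fun n => f n * theta_coef tau n)%C ->
  summable (fun n => f (n - 1)%Z * theta_coef tau n)%C ->
  ((1 - E (a + c)%Z) * finite_theta f a c
   = finite_theta f (a - 1) c - E a * finite_theta (fun n => f (n - 1)%Z) (a - 1) c)%C.
Proof.
  intros Hf Hf'. unfold finite_theta.
  assert (S0 := finite_theta_summable f a c Hf).
  assert (S1 := finite_theta_summable f (a - 1) c Hf).
  assert (S2 := finite_theta_summable _ (a - 1) c Hf').
  assert (S3 := summable_scal (E a) _ S2).
  rewrite <- !Zseries_scal by trivial.
  rewrite <- (Zseries_shift 1 _ S3).
  rewrite <- Zseries_minus by (trivial; apply (summable_shift 1 _ S3)).
  apply Zseries_ext. intros n. cbv beta.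
  rewrite theta_coef_succ.
  replace (n + 1 - 1)%Z with n by lia.
  replace (a - 1 + n)%Z with (a + n - 1)%Z by lia.
  replace (a - 1 + (n + 1))%Z with (a + n)%Z by lia.
  replace (c - (n + 1))%Z with (c - n - 1)%Z by lia.
  rewrite !inv_qpoch_pred.
  replace (a + c)%Z with (a + n + (c - n))%Z by lia. rewrite (E_Zplus (a + n)), (E_Zplus a n). ring.
Qed.

(** The mirror splitting 1 - q^(a+c) = (1 - q^(c-n)) + q^(c-n) (1 - q^(a+n)), with a shift in the
    other direction. *)
Lemma finite_theta_rec_r (f : Z -> C) (a c : Z) :
  summable (fun n => f n * theta_coef tau n)%C ->
  summable (fun n => f (n + 1)%Z * theta_coef tau n)%C ->
  ((1 - E (a + c)%Z) * finite_theta f a c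
   = finite_theta f a (c - 1) - E (c - 1)%Z * finite_theta (fun n => f (n + 1)%Z) a (c - 1))%C.
Proof.
  intros Hf Hf'. unfold finite_theta.
  assert (S0 := finite_theta_summable f a c Hf).
  assert (S1 := finite_theta_summable f a (c - 1) Hf).
  assert (S2 := finite_theta_summable _ a (c - 1) Hf').
  assert (S3 := summable_scal (E (c - 1)%Z) _ S2).
  rewrite <- !Zseries_scal by trivial.
  rewrite <- (Zseries_shift (-1) _ S3).
  rewrite <- Zseries_minus by (trivial; apply (summable_shift (-1) _ S3)).
  apply Zseries_ext. intros n. cbv beta.
  assert (Ht := theta_coef_succ tau (n - 1)). rewrite Z.sub_add in Ht.
  replace (n + -1 + 1)%Z with n by lia.
  replace (n + -1)%Z with (n - 1)%Z by lia.
  replace (c - 1 - n)%Z with (c - n - 1)%Z by lia.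
  replace (a + (n - 1))%Z with (a + n - 1)%Z by lia.
  replace (c - 1 - (n - 1))%Z with (c - n)%Z by lia.
  rewrite !inv_qpoch_pred.
  replace (a + c)%Z with (a + n + (c - n))%Z by lia. rewrite (E_Zplus (a + n)).
  replace (E (c - n)%Z * 1)%C with (E (c - n)%Z) by ring.
  assert (X : (theta_coef tau n * E (c - n)%Z = - (theta_coef tau (n - 1) * E (c - 1)%Z))%C).
  { rewrite Ht. replace (c - 1)%Z with (n - 1 + (c - n))%Z by lia. rewrite E_Zplus. ring. }
  transitivity (f n * theta_coef tau n * inv_qpoch (a + n) * ((1 - E (c - n)%Z) * inv_qpoch (c - n))
    + f n * (theta_coef tau n * E (c - n)%Z) * ((1 - E (a + n)%Z) * inv_qpoch (a + n)) * inv_qpoch (c - n))%C;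
    [ring | rewrite X; ring].
Qed.

Lemma theta_coef_weighted_summable : summable (fun n : Z => n * theta_coef tau n)%C.
Proof.
  apply summable_le with 1 (fun n : Z => n * E (1 / 2 * n ^ 2 + - (1 / 2) * n + 0))%C.
  - intros n. unfold theta_coef. rewrite !Cmod_mult, Cmod_sg.
    replace (n * (n - 1) / 2) with (1 / 2 * n ^ 2 + - (1 / 2) * n + 0) by field. lra.
  - apply gauss_weighted; trivial. lra.
Qed.

Lemma theta_coef_unweighted_summable (c : C) : summable (fun n : Z => c * theta_coef tau n)%C.
Proof. apply summable_scal, theta_coef_summable, Htau. Qed.

Notation W0 := (finite_theta (fun _ => RtoC 1)).
Notation W1 := (finite_theta (fun n => RtoC n)).

Lemma W1_shift (k : Z) (a c : Z) :
  finite_theta (fun n => RtoC (n + k)%Z) a c = (W1 a c + k * W0 a c)%C.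
Proof.
  assert (S0 := finite_theta_summable _ a c (theta_coef_unweighted_summable 1)).
  assert (S1 := finite_theta_summable _ a c theta_coef_weighted_summable).
  unfold finite_theta. rewrite <- Zseries_scal by trivial.
  rewrite <- Zseries_plus by (trivial; now apply summable_scal).
  apply Zseries_ext. intros n. rewrite plus_IZR, RtoC_plus. ring.
Qed.

Lemma shift_weighted_summable (k : Z) : summable (fun n => RtoC (n + k)%Z * theta_coef tau n)%C.
Proof.
  apply summable_ext with (fun n : Z => n * theta_coef tau n + k * theta_coef tau n)%C.
  - intros n. rewrite plus_IZR, RtoC_plus. ring.
  - apply summable_plus; [apply theta_coef_weighted_summable | apply theta_coef_unweighted_summable].
Qed.

Lemma W0_rec_l (a c : Z) : ((1 - E (a + c)%Z) * W0 a c = (1 - E a) * W0 (a - 1)%Z c)%C.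
Proof.
  rewrite finite_theta_rec_l by apply theta_coef_unweighted_summable. ring.
Qed.

Lemma W0_rec_r (a c : Z) : ((1 - E (a + c)%Z) * W0 a c = (1 - E (c - 1)%Z) * W0 a (c - 1)%Z)%C.
Proof.
  rewrite finite_theta_rec_r by apply theta_coef_unweighted_summable. ring.
Qed.

Lemma W1_rec_l (a c : Z) :
  ((1 - E (a + c)%Z) * W1 a c = (1 - E a) * W1 (a - 1)%Z c + E a * W0 (a - 1)%Z c)%C.
Proof.
  rewrite finite_theta_rec_l by (apply theta_coef_weighted_summable || apply (shift_weighted_summable (-1))).
  rewrite (W1_shift (-1)). ring.
Qed.

Lemma W1_rec_r (a c : Z) :
  ((1 - E (a + c)%Z) * W1 a c
   = (1 - E (c - 1)%Z) * W1 a (c - 1)%Z - E (c - 1)%Z * W0 a (c - 1)%Z)%C.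
Proof.
  rewrite finite_theta_rec_r by (apply theta_coef_weighted_summable || apply (shift_weighted_summable 1)).
  rewrite (W1_shift 1). ring.
Qed.

Lemma W0_0_0 : W0 0 0 = RtoC 1.
Proof.
  unfold finite_theta.
  match goal with |- Zseries ?f = _ => destruct (Zseries_support f 0) as [_ ->] end.
  - intros n Hn. unfold inv_qpoch.
    destruct (Z.leb_spec 0 (0 + n)); destruct (Z.leb_spec 0 (0 - n)); try lia; ring.
  - unfold theta_coef, inv_qpoch, sg. simpl. replace (0 * (0 - 1) / 2) with 0 by field.
    rewrite epow_0. field.
Qed.

Lemma one_minus_epow_Z_neq_0 (n : Z) : (0 < n)%Z -> (1 - E n)%C <> RtoC 0.
Proof. intros Hn. apply one_minus_epow_neq_0; trivial. apply not_0_IZR. lia. Qed.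

Lemma Cmult_eq_0_reg_l (x y : C) : x <> RtoC 0 -> (x * y)%C = RtoC 0 -> y = RtoC 0.
Proof.
  intros Hx H. replace y with (/ x * (x * y))%C by (field; trivial). rewrite H. ring.
Qed.

(** The step from c = 0 to c = 1 carries the factor 1 - q^0, the zero of the finite product at z =
    1; the recursions propagate it. *)
Lemma W0_nat_succ (a c : nat) : W0 (Z.of_nat a) (Z.of_nat c + 1) = RtoC 0.
Proof.
  induction c as [| c IH].
  - simpl. induction a as [| a IH].
    + apply Cmult_eq_0_reg_l with (1 := one_minus_epow_Z_neq_0 (0 + 1) ltac:(lia)).
      simpl Z.of_nat. rewrite W0_rec_r. simpl. rewrite epow_0. ring.
    + apply Cmult_eq_0_reg_l with (1 := one_minus_epow_Z_neq_0 (Z.of_nat (S a) + 1) ltac:(lia)).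
      rewrite W0_rec_l. replace (Z.of_nat (S a) - 1)%Z with (Z.of_nat a) by lia. rewrite IH. ring.
  - apply Cmult_eq_0_reg_l with (1 := one_minus_epow_Z_neq_0 (Z.of_nat a + (Z.of_nat (S c) + 1)) ltac:(lia)).
    rewrite W0_rec_r. replace (Z.of_nat (S c) + 1 - 1)%Z with (Z.of_nat c + 1)%Z by lia.
    rewrite IH. ring.
Qed.

(** At a = 0 the factor 1 - q^0 removes [W1 0 0], and only -[W0 0 0] = -1 survives: differentiating
    a product at a simple zero leaves the remaining factors. For larger a the correction by [W0]
    vanishes. *)
Lemma W1_nat_1 (a : nat) : ((1 - E (Z.of_nat a + 1)%Z) * W1 (Z.of_nat a) 1 = - (1))%C.
Proof.
  induction a as [| a IH].
  - rewrite W1_rec_r. simpl. rewrite W0_0_0, epow_0. ring.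
  - rewrite W1_rec_l. replace (Z.of_nat (S a) - 1)%Z with (Z.of_nat a) by lia.
    rewrite (W0_nat_succ a 0 : W0 (Z.of_nat a) 1 = RtoC 0). replace (Z.of_nat (S a)) with (Z.of_nat a + 1)%Z by lia.
    rewrite IH. ring.
Qed.

(* A finite form of Jacobi's identity for (q)_oo^3. *)
Lemma W1_closed (a c : nat) :
  (W1 (Z.of_nat a) (Z.of_nat c + 1) * P (a + c + 1) = - (P a * P c))%C.
Proof.
  induction c as [| c IH].
  - replace (a + 0 + 1)%nat with (S a) by lia. rewrite qpoch_S. simpl.
    rewrite <- (Cmult_1_r (P a)) at 2.
    transitivity (P a * ((1 - E (Z.of_nat a + 1)) * W1 (Z.of_nat a) 1))%C; [simpl; ring |].
    rewrite <- plus_IZR, W1_nat_1. ring.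
  - replace (a + S c + 1)%nat with (S (a + c + 1)) by lia. rewrite !qpoch_S.
    transitivity (P (a + c + 1) * ((1 - E (Z.of_nat a + (Z.of_nat (S c) + 1))%Z) * W1 (Z.of_nat a) (Z.of_nat (S c) + 1)))%C.
    + replace (Z.of_nat a + (Z.of_nat (S c) + 1))%Z with (Z.of_nat (a + c + 1) + 1)%Z by lia.
      rewrite (plus_IZR (Z.of_nat (a + c + 1))). ring.
    + rewrite W1_rec_r. replace (Z.of_nat (S c) + 1 - 1)%Z with (Z.of_nat c + 1)%Z by lia.
      rewrite W0_nat_succ, plus_IZR.
      transitivity ((1 - E (Z.of_nat c + 1)) * (W1 (Z.of_nat a) (Z.of_nat c + 1) * P (a + c + 1)))%C;
        [ring | rewrite IH; ring].
Qed.

(** Let both cut-offs grow in [W1_closed]: by dominated convergence the left side tends to (q)_oo S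
    / (q)_oo^2, with S the theta sum weighted by n, and the right side to -(q)_oo^2. *)
Lemma Jacobi_cube :
  Zseries (fun n : Z => n * theta_coef tau n)%C = (- Cpow (qpoch_inf (E 1)) 3)%C.
Proof.
  set (L := qpoch_inf (E 1)). assert (HL : L <> RtoC 0) by apply qpoch_inf_neq_0.
  set (S := Zseries _).
  destruct inv_qpoch_bound as [M [HM B]].
  destruct qpoch_bounds as [c [M' [Hc BP]]].
  assert (HW : Clim (fun N => W1 (Z.of_nat N) (Z.of_nat N + 1)) (S * (/ L * / L))%C).
  { unfold S. rewrite Cmult_comm, <- Zseries_scal by apply theta_coef_weighted_summable.
    unfold finite_theta. apply Zseries_Tannery with (fun n : Z => RtoC (M * M) * (n * theta_coef tau n))%C.
    - intros N n.
      rewrite 2!(Cmod_mult (_ * _)), (Cmod_mult (RtoC (M * M))), Rmult_assoc, Rmult_comm.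
      rewrite Cmod_R, Rabs_pos_eq by now apply Rmult_le_pos.
      apply Rmult_le_compat_r; [apply Cmod_ge_0 |].
      apply Rmult_le_compat; trivial; apply Cmod_ge_0.
    - apply summable_scal, theta_coef_weighted_summable.
    - intros n. cbv beta. rewrite (Cmult_comm (/ L * / L)).
      apply Clim_ext with (fun N => n * theta_coef tau n * (inv_qpoch (Z.of_nat N + n) * inv_qpoch (Z.of_nat N + (1 - n))))%C.
      + intros N. replace (Z.of_nat N + 1 - n)%Z with (Z.of_nat N + (1 - n))%Z by lia. ring.
      + apply Clim_scal, Clim_mult; try apply inv_qpoch_lim. exists M. intros N. apply B. }
  assert (HP2 : Clim (fun N => P (N + N + 1)) L).
  { unfold Clim. apply (is_lim_seq_subseq (fun n => Cmod (P n - L)) _ (fun N => (N + N + 1)%nat)).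
    - apply eventually_subseq. intros n. lia.
    - apply qpoch_inf_lim. }
  assert (H1 : Clim (fun N => P (N + N + 1) * W1 (Z.of_nat N) (Z.of_nat N + 1))%C (L * (S * (/ L * / L)))%C).
  { apply Clim_mult; trivial. exists M'. intros n. apply BP. }
  assert (H2 : Clim (fun N => - (1) * (P N * P N))%C (- (1) * (L * L))%C).
  { apply Clim_scal, Clim_mult; try apply qpoch_inf_lim. exists M'. intros n. apply BP. }
  assert (Q : (L * (S * (/ L * / L)) = - (1) * (L * L))%C).
  { apply (Clim_unique _ _ _ H1). revert H2. apply Clim_ext. intros N.
    rewrite Cmult_comm with (x := P (N + N + 1)), W1_closed. ring. }
  replace S with (L * (L * (S * (/ L * / L))))%C by (field; trivial).
  rewrite Q. simpl. ring.
Qed.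

Lemma theta_recip_convolution (m : Z) :
  Zseries (fun i => theta_coef tau i * recip_coef tau (m - i))%C
  = (Cpow (qpoch_inf (E 1)) 3 * Zdelta 0 m)%C.
Proof.
  unfold Zdelta. destruct (Z.eq_dec m 0) as [-> | Hm].
  - rewrite (theta_recip_diagonal tau Htau : Zseries (fun i => theta_coef tau i * recip_coef tau (0 - i))%C = _).
    rewrite Jacobi_cube. ring.
  - rewrite theta_recip_off_diagonal by trivial. ring.
Qed.

End Jacobi.

(** * Uniqueness of Laurent coefficients *)

Lemma is_Cseries_bounded (f : nat -> C) (l : C) :
  is_Cseries f l -> exists M, forall n, Cmod (f n) <= M.
Proof.
  intros H.
  destruct (filterlim_bounded (V := C_NormedModule) (sum_n (G := C_AbelianMonoid) f)) as [M HM].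
  { now exists l. }
  assert (HM' : forall n, Cmod (sum_n (G := C_AbelianMonoid) f n) <= M) by exact HM.
  exists (M + M). intros n. destruct n as [| n].
  - specialize (HM' 0%nat). rewrite sum_O in HM'. generalize (Cmod_ge_0 (f 0%nat)). lra.
  - assert (Q : f (S n) = (sum_n (G := C_AbelianMonoid) f (S n) - sum_n (G := C_AbelianMonoid) f n)%C).
    { rewrite sum_Sn. unfold plus; simpl. ring. }
    rewrite Q. eapply Rle_trans; [apply Cmod_triangle |]. rewrite Cmod_opp.
    generalize (HM' n) (HM' (S n)). lra.
Qed.

Lemma is_Zseries_bounded (f : Z -> C) (l : C) :
  is_Zseries f l -> exists M, forall n, Cmod (f n) <= M.
Proof.
  intros [a [b [Ha [Hb _]]]].
  destruct (is_Cseries_bounded _ _ Ha) as [M1 H1].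
  destruct (is_Cseries_bounded _ _ Hb) as [M2 H2].
  exists (Rmax M1 M2). intros n. destruct (Z.le_gt_cases 0 n) as [Hn | Hn].
  - specialize (H1 (Z.to_nat n)). rewrite Z2Nat.id in H1 by lia.
    eapply Rle_trans; [exact H1 | apply Rmax_l].
  - specialize (H2 (Z.to_nat (- n - 1))).
    replace (- Z.of_nat (S (Z.to_nat (- n - 1))))%Z with n in H2 by lia.
    eapply Rle_trans; [exact H2 | apply Rmax_r].
Qed.

(** Here 2^a is the exact power of 2 dividing k, so the value is e^(pi i) to an odd power. *)
Lemma dyadic_root (k : Z) : k <> 0%Z -> exists a : nat, epow 1 (/ 2 ^ S a * k) = (- (1))%C.
Proof.
  assert (H : forall (n : nat) k, (Z.abs k <= Z.of_nat n)%Z -> k <> 0%Z ->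
     exists a : nat, epow 1 (/ 2 ^ S a * k) = (- (1))%C).
  { clear k. induction n as [| n IH]; intros k Hk Hk0; [lia |].
    destruct (Z.Even_or_Odd k) as [[k' ->] | [k' ->]].
    - destruct (IH k') as [a Ha]; [lia | lia |]. exists (S a). rewrite <- Ha. f_equal.
      rewrite mult_IZR. simpl. field. apply pow_nonzero. lra.
    - exists 0%nat. replace (/ 2 ^ 1 * (2 * k' + 1)%Z) with ((2 * k' + 1)%Z / 2) by (simpl; field).
      rewrite <- sg_epow, sg_succ, sg_mul_even. ring. }
  intros Hk. apply (H (Z.to_nat (Z.abs k))); trivial. lia.
Qed.

(* Averaging over x and x + 2^-(M+1) for M = 0, 1, ... kills every frequency but 0. *)
Fixpoint dyadic_weight (M : nat) (k : Z) : C :=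
  match M with
  | O => RtoC 1
  | S M' => (/ 2 * (1 + epow 1 (/ 2 ^ S M' * k)) * dyadic_weight M' k)%C
  end.

Lemma dyadic_weight_le_1 (M : nat) (k : Z) : Cmod (dyadic_weight M k) <= 1.
Proof.
  induction M as [| M IH].
  - simpl. rewrite Cmod_1. lra.
  - change (Cmod (/ 2 * (1 + epow 1 (/ 2 ^ S M * k)) * dyadic_weight M k) <= 1).
    rewrite !Cmod_mult.
    assert (A : Cmod (1 + epow 1 (/ 2 ^ S M * k)) <= 2).
    { eapply Rle_trans; [apply Cmod_triangle |]. rewrite Cmod_1, Cmod_epow. simpl Im.
      rewrite Rmult_0_r, Ropp_0, exp_0. lra. }
    rewrite Cmod_inv by (apply Cmod_gt_0; rewrite Cmod_R, Rabs_pos_eq; lra).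
    rewrite Cmod_R, Rabs_pos_eq by lra.
    generalize (Cmod_ge_0 (dyadic_weight M k)) (Cmod_ge_0 (1 + epow 1 (/ 2 ^ S M * k))). nra.
Qed.

Lemma dyadic_weight_0 (M : nat) : dyadic_weight M 0 = RtoC 1.
Proof.
  induction M as [| M IH]; [reflexivity |].
  change (dyadic_weight (S M) 0) with (/ 2 * (1 + epow 1 (/ 2 ^ S M * 0)) * dyadic_weight M 0)%C.
  rewrite IH, Rmult_0_r, epow_0. field.
Qed.

Lemma dyadic_weight_lim (k : Z) : k <> 0%Z -> Clim (fun M => dyadic_weight M k) 0.
Proof.
  intros Hk. destruct (dyadic_root k Hk) as [a Ha].
  assert (H : forall n, dyadic_weight (n + S a) k = RtoC 0).
  { induction n as [| n IH].
    - change (0 + S a)%nat with (S a). change (dyadic_weight (S a) k) with (/ 2 * (1 + epow 1 (/ 2 ^ S a * k)) * dyadic_weight a k)%C.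
      rewrite Ha. ring.
    - change (S n + S a)%nat with (S (n + S a)). change (dyadic_weight (S (n + S a)) k)
        with (/ 2 * (1 + epow 1 (/ 2 ^ S (n + S a) * k)) * dyadic_weight (n + S a) k)%C.
      rewrite IH. ring. }
  apply (is_lim_seq_incr_n _ (S a)).
  apply (Clim_ext (fun _ => RtoC 0)); [| apply Clim_const]. intros n. now rewrite H.
Qed.

(** Stands in for integration over a period. The averaged series are means of translates of the zero
    function, hence 0, while their weights tend to the point mass at frequency 0; dominated
    convergence leaves v 0. *)
Lemma Fourier_unique (v : Z -> C) :
  summable v -> (forall x : R, Zseries (fun k => v k * epow x k)%C = RtoC 0) -> v 0%Z = RtoC 0.
Proof.
  intros Hv H.
  assert (Hw : forall M (x : R), summable (fun k => v k * dyadic_weight M k * epow x k)%C).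
  { intros M x. apply summable_le with 1 v; trivial. intros k.
    rewrite !Cmod_mult, Cmod_epow. simpl Im. rewrite Rmult_0_r, Ropp_0, exp_0.
    generalize (dyadic_weight_le_1 M k) (Cmod_ge_0 (v k)). nra. }
  assert (K : forall M (x : R), Zseries (fun k => v k * dyadic_weight M k * epow x k)%C = RtoC 0).
  { induction M as [| M IH]; intros x.
    - rewrite <- (H x). apply Zseries_ext. intros k. simpl. ring.
    - rewrite (Zseries_ext _ (fun k => / 2 * (v k * dyadic_weight M k * epow x k
          + v k * dyadic_weight M k * epow (x + / 2 ^ S M)%R k))%C).
      + rewrite Zseries_scal, Zseries_plus, !IH by (try apply summable_plus; apply Hw). ring.
      + intros k.
        change (dyadic_weight (S M) k) with (/ 2 * (1 + epow 1 (/ 2 ^ S M * k)) * dyadic_weight M k)%C.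
        rewrite RtoC_plus, epow_plus_base.
        rewrite <- (epow_scal_base (/ 2 ^ S M) 1 k), Cmult_1_r. ring. }
  assert (L : Clim (fun M => Zseries (fun k => v k * dyadic_weight M k * epow 0 k)%C)
     (Zseries (fun k => v k * Zdelta 0 k)%C)).
  { apply Zseries_Tannery with v; trivial.
    - intros M k. rewrite !Cmod_mult, Cmod_epow. simpl Im. rewrite Rmult_0_r, Ropp_0, exp_0.
      generalize (dyadic_weight_le_1 M k) (Cmod_ge_0 (v k)). nra.
    - intros k. apply Clim_ext with (fun M => v k * epow 0 k * dyadic_weight M k)%C.
      { intros M. ring. }
      replace (v k * Zdelta 0 k)%C with (v k * epow 0 k * Zdelta 0 k)%C.
      + apply Clim_scal. unfold Zdelta. destruct (Z.eq_dec k 0) as [-> | Hk].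
        * apply Clim_ext with (fun _ => RtoC 1); [| apply Clim_const].
          intros M. now rewrite dyadic_weight_0.
        * now apply dyadic_weight_lim.
      + rewrite epow_expand. simpl.
        rewrite !Rmult_0_r, Ropp_0, exp_0, cos_0, sin_0, Rmult_1_r, Rmult_0_r.
        change (1, 0) with (RtoC 1). ring. }
  match type of L with Clim _ (Zseries ?g) => destruct (Zseries_support g 0) as [_ E0] end.
  { intros n Hn. unfold Zdelta. destruct Z.eq_dec; [contradiction | ring]. }
  rewrite E0 in L. unfold Zdelta in L. simpl in L.
  replace (v 0%Z) with (v 0%Z * 1)%C by ring.
  apply (Clim_unique _ _ _ L). apply Clim_ext with (fun _ => RtoC 0); [| apply Clim_const].
  intros M. now rewrite K.
Qed.

(** The hypothesis gives only convergence, whereas [Fourier_unique] wants absolute summability. The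
    latter holds on the middle circle Im w = T/2, by comparison with the bounded terms on a smaller
    and a larger circle. Multiplying by a power of e^(2 pi i x) moves the index n0 to 0. *)
Lemma Laurent_unique (T : R) (d : Z -> C) : 0 < T ->
  (forall w : C, 0 < Im w < T -> is_Zseries (fun n => d n * epow w n)%C 0) ->
  forall n, d n = RtoC 0.
Proof.
  intros HT H n0.
  set (w := fun a : R => (0, a * T) : C).
  assert (B : forall a, 0 < a < 1 -> exists M, forall n, Cmod (d n) * exp (- (2 * PI * n * (a * T))) <= M).
  { intros a Ha. destruct (is_Zseries_bounded _ _ (H (w a) ltac:(simpl; nra))) as [M HM].
    exists M. intros n. specialize (HM n). now rewrite Cmod_mult, Cmod_epow in HM. }
  (* The circle at T/4 dominates the indices n >= 0, the one at 3T/4 the indices n <= 0; either is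
     at distance T/4 from the middle, whence the rate [c]. *)
  destruct (B (/ 4)) as [M1 H1]; [lra |]. destruct (B (3 / 4)) as [M2 H2]; [lra |].
  set (c := 2 * PI * T / 4).
  assert (Hc : 0 < c) by (unfold c; generalize (Rmult_lt_0_compat _ _ PI_RGT_0 HT); lra).
  set (w0 := w (/ 2)).
  assert (S1 : summable (fun n => d n * epow w0 n)%C).
  { apply summable_le with (Rmax M1 M2) (fun n => RtoC (exp (- (c * Rabs n)))); [| now apply exp_decay_summable].
    intros n. rewrite Cmod_mult, Cmod_epow, Cmod_R, (Rabs_pos_eq (exp _)) by apply Rlt_le, exp_pos.
    assert (P : forall a M, Cmod (d n) * exp (- (2 * PI * n * (a * T))) <= M -> M <= Rmax M1 M2 ->
       - (2 * PI * n * (/ 2 * T)) = - (2 * PI * n * (a * T)) + - (c * Rabs n) ->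
       Cmod (d n) * exp (- (2 * PI * n * (/ 2 * T))) <= Rmax M1 M2 * exp (- (c * Rabs n))).
    { intros a M HM HMM Ha. rewrite Ha, exp_plus, <- Rmult_assoc.
      apply Rmult_le_compat_r; [apply Rlt_le, exp_pos | lra]. }
    change (Im w0) with (/ 2 * T).
    destruct (Z.le_ge_cases 0 n) as [Hn | Hn].
    - apply (P (/ 4) M1); [apply H1 | apply Rmax_l |].
      rewrite Rabs_pos_eq by now apply IZR_le. unfold c. field.
    - apply (P (3 / 4) M2); [apply H2 | apply Rmax_r |].
      rewrite Rabs_left1 by now apply IZR_le. unfold c. field. }
  assert (F : (d (0 + n0)%Z * epow w0 (0 + n0)%Z)%C = RtoC 0).
  { apply (Fourier_unique (fun n => d (n + n0)%Z * epow w0 (n + n0)%Z)%C).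
    - apply (summable_shift n0 (fun n => d n * epow w0 n)%C S1).
    - intros x.
      assert (Hx := H (w0 + x)%C). specialize (Hx ltac:(simpl; lra)).
      apply (is_Zseries_shift n0), (is_Zseries_scal (epow x (- n0))) in Hx.
      rewrite Cmult_0_r in Hx. apply Zseries_eq. revert Hx. apply is_Zseries_ext. intros n.
      rewrite epow_plus_base, (plus_IZR n), (epow_plus x), epow_opp. field. apply epow_neq_0. }
  simpl in F.
  replace (d n0) with (/ epow w0 n0 * (d n0 * epow w0 n0))%C.
  - rewrite F. ring.
  - field. apply epow_neq_0.
Qed.

(** * The Laurent expansion of the characters *)

(** Serves to recognise the two theta series of the Weyl denominator as the even and odd parts of
    one. *)
Lemma Zseries_parity (f : Z -> C) :
  summable (fun i => f (2 * i)%Z) -> summable (fun i => f (2 * i + 1)%Z) ->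
  summable f /\
  Zseries f = (Zseries (fun i => f (2 * i)%Z) + Zseries (fun i => f (2 * i + 1)%Z))%C.
Proof.
  intros H0 H1.
  destruct (Zseries_pushforward _ (fun i => 2 * i)%Z H0) as [S0 E0].
  destruct (Zseries_pushforward _ (fun i => 2 * i + 1)%Z H1) as [S1 E1].
  set (F0 := fun m => Zseries (fun i => f (2 * i)%Z * Zdelta (2 * i) m)%C) in *.
  set (F1 := fun m => Zseries (fun i => f (2 * i + 1)%Z * Zdelta (2 * i + 1) m)%C) in *.
  assert (E : forall m, (F0 m + F1 m)%C = f m).
  { intros m. unfold F0, F1. destruct (Z.Even_or_Odd m) as [[k ->] | [k ->]].
    - match goal with |- (Zseries ?g + _)%C = _ => destruct (Zseries_support g k) as [_ ->] end.
      { intros n Hn. unfold Zdelta. destruct Z.eq_dec; [lia | ring]. }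
      rewrite Zseries_zero.
      + unfold Zdelta. destruct Z.eq_dec; [ring | lia].
      + intros n. unfold Zdelta. destruct Z.eq_dec; [lia | ring].
    - match goal with |- (_ + Zseries ?g)%C = _ => destruct (Zseries_support g k) as [_ ->] end.
      { intros n Hn. unfold Zdelta. destruct Z.eq_dec; [lia | ring]. }
      rewrite Zseries_zero.
      + unfold Zdelta. destruct Z.eq_dec; [ring | lia].
      + intros n. unfold Zdelta. destruct Z.eq_dec; [lia | ring]. }
  split.
  - apply summable_ext with (1 := E). now apply summable_plus.
  - rewrite <- (Zseries_ext _ _ E), Zseries_plus by trivial. now rewrite E0, E1.
Qed.

Section Character.

Variable tau : C.
Hypothesis Htau : 0 < Im tau.

Notation E := (epow tau).
Notation theta := (theta_coef tau).
Notation recip := (recip_coef tau).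
Notation K := (Cpow (qpoch_inf (epow tau 1)) 3).

(** In modulus a power of z is a real power of q, so the Gaussian estimates in q also cover series
    in z. *)
Lemma Cmod_epow_base (w : C) (a : R) : Cmod (epow w a) = Cmod (E (a * (Im w / Im tau))).
Proof. rewrite !Cmod_epow. f_equal. field. lra. Qed.

Lemma theta_series_summable (w : C) : summable (fun n => theta n * epow w n)%C.
Proof.
  apply summable_le with 1 (fun n : Z => E (1 / 2 * n ^ 2 + (Im w / Im tau - 1 / 2) * n + 0)).
  - intros n. unfold theta_coef. rewrite !Cmod_mult, Cmod_sg, (Cmod_epow_base w), !Rmult_1_l.
    rewrite <- Cmod_mult, <- epow_plus. right. f_equal. f_equal. field. lra.
  - apply gauss_summable; trivial. lra.
Qed.

(** Used with a = 0 for the reciprocal series, bounded at +oo, and with a = 1 for the character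
    coefficients, which decay at both ends. *)
Lemma annulus_summable (a M : R) (b : Z -> C) (w : C) :
  (forall n : Z, Cmod (b n) <= M * Cmod (E (a * n))) ->
  (forall n : Z, Cmod (b n) <= M * Cmod (E (- n))) ->
  - (a * Im tau) < Im w < Im tau -> summable (fun n => b n * epow w n)%C.
Proof.
  intros H1 H2 Hw.
  set (c := 2 * PI * Rmin (a * Im tau + Im w) (Im tau - Im w)).
  assert (Hc : 0 < c).
  { unfold c. apply Rmult_lt_0_compat; [generalize PI_RGT_0; lra |]. apply Rmin_glb_lt; lra. }
  assert (HM : 0 <= M).
  { specialize (H2 0%Z). rewrite Ropp_0, epow_0, Cmod_1 in H2. generalize (Cmod_ge_0 (b 0%Z)). lra. }
  apply summable_le with M (fun n => RtoC (exp (- (c * Rabs n)))); [| now apply exp_decay_summable].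
  assert (P2 : 0 < 2 * PI) by (generalize PI_RGT_0; lra).
  intros n. rewrite Cmod_mult, Cmod_R, (Rabs_pos_eq (exp _)) by apply Rlt_le, exp_pos.
  assert (G : forall e, Cmod (b n) <= M * Cmod (E e) ->
    c * Rabs n <= 2 * PI * e * Im tau + 2 * PI * n * Im w ->
    Cmod (b n) * Cmod (epow w n) <= M * exp (- (c * Rabs n))).
  { intros e He Hle. apply Rle_trans with (M * Cmod (E e) * Cmod (epow w n)).
    - apply Rmult_le_compat_r; [apply Cmod_ge_0 | trivial].
    - rewrite Rmult_assoc. apply Rmult_le_compat_l; trivial.
      rewrite !Cmod_epow, <- exp_plus.
      destruct Hle as [Hle | Hle]; [left; apply exp_increasing; lra | right; f_equal; lra]. }
  destruct (Z.le_ge_cases 0 n) as [Hn | Hn]; apply IZR_le in Hn.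
  - apply (G (a * n)); [apply H1 |]. rewrite Rabs_pos_eq by trivial. unfold c.
    generalize (Rmin_l (a * Im tau + Im w) (Im tau - Im w)). intros Q.
    assert (Q' : 2 * PI * Rmin (a * Im tau + Im w) (Im tau - Im w) * n <= 2 * PI * (a * Im tau + Im w) * n).
    { apply Rmult_le_compat_r; [lra |]. apply Rmult_le_compat_l; lra. }
    lra.
  - apply (G (- n)); [apply H2 |]. rewrite Rabs_left1 by trivial. unfold c.
    generalize (Rmin_r (a * Im tau + Im w) (Im tau - Im w)). intros Q.
    assert (Q' : 2 * PI * Rmin (a * Im tau + Im w) (Im tau - Im w) * - n <= 2 * PI * (Im tau - Im w) * - n).
    { apply Rmult_le_compat_r; [lra |]. apply Rmult_le_compat_l; lra. }
    lra.
Qed.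

Lemma qpoch_inf_cube_neq_0 : K <> RtoC 0.
Proof. apply Cpow_nz, qpoch_inf_neq_0, Htau. Qed.

(** On this strip the reciprocal series converges, and its product with theta is (q)_oo^3, which is
    not 0. *)
Lemma theta_series_neq_0 (w : C) :
  0 < Im w < Im tau -> Zseries (fun n => theta n * epow w n)%C <> RtoC 0.
Proof.
  intros Hw H.
  destruct (recip_coef_bound tau Htau) as [M [HM B]].
  assert (S2 : summable (fun n => recip n * epow w n)%C).
  { apply annulus_summable with 0 M.
    - intros n. rewrite Rmult_0_l, epow_0, Cmod_1, Rmult_1_r. apply B.
    - intros n. apply B.
    - lra. }
  destruct (Zseries_mult _ _ (theta_series_summable w) S2) as [_ Q].
  rewrite H in Q.
  assert (Q' : Zseries (fun m => Zseries (fun i => (theta i * epow w i) *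
       (recip (m - i) * epow w (m - i)%Z)))%C = K).
  { rewrite (Zseries_ext _ (fun m => K * (Zdelta 0 m))%C).
    - rewrite Zseries_scal by apply Zdelta_sum. rewrite (proj2 (Zdelta_sum 0)). ring.
    - intros m. rewrite (Zseries_ext _ (fun i => epow w m * (theta i * recip (m - i)))%C).
      + rewrite Zseries_scal by now apply theta_recip_summable.
        rewrite theta_recip_convolution by trivial.
        unfold Zdelta. destruct (Z.eq_dec m 0) as [-> | Hm]; [rewrite epow_0; ring | ring].
      + intros i. replace (epow w m) with (epow w i * epow w (m - i)%Z)%C; [ring |].
        rewrite <- epow_plus, <- plus_IZR. do 2 f_equal. lia. }
  rewrite Q' in Q. apply qpoch_inf_cube_neq_0. rewrite Q. ring.
Qed.

(** The coefficient of z^m in the formal product of sum g_k z^k with the sparse series sum x_i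
    z^(-e_i). *)
Definition recip_transform (x : Z -> C) (e : Z -> Z) (m : Z) : C :=
  Zseries (fun i => x i * recip (m + e i))%C.

Section Transform.

Variables (x : Z -> C) (e : Z -> Z).
Hypothesis x_summable : summable x.
Hypothesis x_up : summable (fun i => x i * E (e i))%C.
Hypothesis x_down : summable (fun i => x i * E (- e i))%C.

Lemma recip_transform_summable (m : Z) : summable (fun i => x i * recip (m + e i))%C.
Proof.
  destruct (recip_coef_bound tau Htau) as [M [HM B]].
  apply summable_le with M x; trivial. intros i. rewrite Cmod_mult, Rmult_comm.
  apply Rmult_le_compat_r; [apply Cmod_ge_0 | apply B].
Qed.

Lemma recip_transform_bound_down :
  exists M, 0 <= M /\ forall m : Z, Cmod (recip_transform x e m) <= M * Cmod (E (- m)).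
Proof.
  destruct (recip_coef_bound tau Htau) as [M [HM B]].
  exists (M * Znorm (fun i => x i * E (- e i))%C).
  split; [apply Rmult_le_pos; trivial; apply Znorm_ge_0 |]. intros m.
  eapply Rle_trans; [apply Zseries_Cmod_le, recip_transform_summable |].
  rewrite Rmult_assoc, (Rmult_comm (Znorm _)), <- Rmult_assoc.
  apply Znorm_le; trivial. intros i. rewrite !Cmod_mult.
  destruct (B (m + e i)%Z) as [_ B2].
  replace (M * Cmod (E (- m)) * (Cmod (x i) * Cmod (E (- e i))))
    with (Cmod (x i) * (M * (Cmod (E (- m)) * Cmod (E (- e i))))) by ring.
  apply Rmult_le_compat_l; [apply Cmod_ge_0 |].
  rewrite <- Cmod_mult, <- epow_plus, <- Ropp_plus_distr, <- plus_IZR. exact B2.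
Qed.

(** Since g_k -> 1, the transform tends at +oo to the value of the sparse series at z = 1, at the
    rate |q|^m. *)
Lemma recip_transform_bound_up :
  exists M, 0 <= M /\ forall m : Z, Cmod (recip_transform x e m - Zseries x) <= M * Cmod (E m).
Proof.
  destruct (recip_coef_minus_1_bound tau Htau) as [M [HM B]].
  exists (M * Znorm (fun i => x i * E (e i))%C).
  split; [apply Rmult_le_pos; trivial; apply Znorm_ge_0 |]. intros m.
  unfold recip_transform.
  rewrite <- Zseries_minus by (trivial; apply recip_transform_summable).
  eapply Rle_trans;
    [apply Zseries_Cmod_le, summable_minus; trivial; apply recip_transform_summable |].
  rewrite Rmult_assoc, (Rmult_comm (Znorm _)), <- Rmult_assoc.
  apply Znorm_le; trivial. intros i.
  replace (x i * recip (m + e i) - x i)%C with (x i * (recip (m + e i) - 1))%C by ring.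
  rewrite !Cmod_mult.
  replace (M * Cmod (E m) * (Cmod (x i) * Cmod (E (e i))))
    with (Cmod (x i) * (M * (Cmod (E m) * Cmod (E (e i))))) by ring.
  apply Rmult_le_compat_l; [apply Cmod_ge_0 |].
  rewrite <- Cmod_mult, <- epow_plus, <- plus_IZR. apply B.
Qed.

Lemma theta_recip_transform_summable (m : Z) :
  summable (fun k => theta k * recip_transform x e (m - k))%C.
Proof.
  destruct (recip_coef_bound tau Htau) as [M [HM B]].
  apply summable_le with (M * Znorm x) theta; [| now apply theta_coef_summable].
  intros k. rewrite Cmod_mult, Rmult_comm. apply Rmult_le_compat_r; [apply Cmod_ge_0 |].
  eapply Rle_trans; [apply Zseries_Cmod_le, recip_transform_summable |].
  apply Znorm_le; trivial. intros i. rewrite Cmod_mult, Rmult_comm.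
  apply Rmult_le_compat_r; [apply Cmod_ge_0 | apply B].
Qed.

(** Convolving with theta undoes the transform up to (q)_oo^3: after the interchange of sums each i
    contributes [theta_recip_convolution] at m + e i. *)
Lemma theta_recip_transform (m : Z) :
  Zseries (fun k => theta k * recip_transform x e (m - k))%C
  = (K * Zseries (fun i => x i * Zdelta (- e i) m))%C.
Proof.
  destruct (recip_coef_bound tau Htau) as [M [HM B]].
  rewrite (Zseries_ext _ (fun k => Zseries (fun i => theta k * (x i * recip (m - k + e i))))%C).
  2: { intros k. unfold recip_transform. rewrite Zseries_scal; trivial. apply recip_transform_summable. }
  rewrite (Zseries_swap_bounded x (fun k => M * theta k)%C (fun i k => theta k * (x i * recip (m - k + e i)))%C); trivial.
  - rewrite <- Zseries_scal.
    + apply Zseries_ext. intros i.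
      rewrite (Zseries_ext _ (fun k => x i * (theta k * recip (m + e i - k)))%C).
      * rewrite Zseries_scal by now apply theta_recip_summable.
        rewrite theta_recip_convolution by trivial.
        unfold Zdelta. do 2 destruct Z.eq_dec; try lia; ring.
      * intros k. replace (m - k + e i)%Z with (m + e i - k)%Z by lia. ring.
    + apply summable_le with 1 x; trivial. intros i. rewrite Cmod_mult.
      unfold Zdelta. destruct Z.eq_dec; rewrite ?Cmod_1, ?Cmod_0; generalize (Cmod_ge_0 (x i)); lra.
  - apply summable_scal, theta_coef_summable, Htau.
  - intros i k. rewrite !Cmod_mult, Cmod_R, Rabs_pos_eq by trivial.
    replace (Cmod (x i) * (M * Cmod (theta k))) with (Cmod (theta k) * (Cmod (x i) * M)) by ring.
    apply Rmult_le_compat_l; [apply Cmod_ge_0 |]. apply Rmult_le_compat_l; [apply Cmod_ge_0 | apply B].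
Qed.

Lemma coef_pushforward (w : C) :
  summable (fun i => x i * epow w (- e i))%C ->
  summable (fun m => epow w m * Zseries (fun i => x i * Zdelta (- e i) m))%C /\
  Zseries (fun m => epow w m * Zseries (fun i => x i * Zdelta (- e i) m))%C
  = Zseries (fun i => x i * epow w (- e i))%C.
Proof.
  intros Hs. destruct (Zseries_pushforward _ (fun i => - e i)%Z Hs) as [S1 E1].
  assert (Eq : forall m, Zseries (fun i => x i * epow w (- e i) * Zdelta (- e i) m)%C
     = (epow w m * Zseries (fun i => x i * Zdelta (- e i) m))%C).
  { intros m. rewrite <- Zseries_scal.
    - apply Zseries_ext. intros i. unfold Zdelta.
      destruct Z.eq_dec as [-> |]; [rewrite opp_IZR |]; ring.
    - apply summable_le with 1 x; trivial. intros i. rewrite Cmod_mult.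
      unfold Zdelta. destruct Z.eq_dec; rewrite ?Cmod_1, ?Cmod_0; generalize (Cmod_ge_0 (x i)); lra. }
  split.
  - apply summable_ext with (1 := Eq). exact S1.
  - rewrite <- (Zseries_ext _ _ Eq). exact E1.
Qed.

End Transform.

End Character.

(** * Finite sums *)

Fixpoint csum (f : nat -> C) (n : nat) : C :=
  match n with
  | O => RtoC 0
  | S k => (csum f k + f k)%C
  end.

Lemma csum_ext (f g : nat -> C) (n : nat) :
  (forall k, (k < n)%nat -> f k = g k) -> csum f n = csum g n.
Proof.
  induction n as [| n IH]; intros H; [reflexivity |]. simpl. rewrite IH, H; trivial; [lia |].
  intros k Hk. apply H. lia.
Qed.

Lemma csum_plus (f g : nat -> C) (n : nat) :
  csum (fun k => f k + g k)%C n = (csum f n + csum g n)%C.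
Proof. induction n as [| n IH]; simpl; [ring | rewrite IH; ring]. Qed.

Lemma csum_scal (c : C) (f : nat -> C) (n : nat) :
  csum (fun k => c * f k)%C n = (c * csum f n)%C.
Proof. induction n as [| n IH]; simpl; [ring | rewrite IH; ring]. Qed.

Lemma csum_split (f : nat -> C) (m n : nat) :
  csum f (m + n) = (csum f m + csum (fun k => f (m + k)%nat) n)%C.
Proof.
  induction n as [| n IH].
  - rewrite Nat.add_0_r. simpl. ring.
  - rewrite Nat.add_succ_r. simpl. rewrite IH. ring.
Qed.

Lemma csum_first (f : nat -> C) (n : nat) :
  csum f (S n) = (f 0%nat + csum (fun k => f (S k)) n)%C.
Proof. rewrite (csum_split f 1 n : csum f (S n) = _). simpl. ring. Qed.

Lemma csum_rev (f : nat -> C) (n : nat) :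
  csum f n = csum (fun k => f (n - 1 - k)%nat) n.
Proof.
  induction n as [| n IH]; [reflexivity |].
  rewrite (csum_first (fun k => f (S n - 1 - k)%nat)). change (csum f (S n)) with (csum f n + f n)%C. rewrite IH.
  replace (S n - 1 - 0)%nat with n by lia.
  rewrite (csum_ext (fun k => f (S n - 1 - S k)%nat) (fun k => f (n - 1 - k)%nat)); [ring |].
  intros k Hk. f_equal. lia.
Qed.

(** The centre is [S p]. Once the zero terms at 0 and at the centre are dropped, p terms remain on
    either side; reversing the lower block pairs them symmetrically. *)
Lemma csum_centered (a : Z -> C) (p : nat) :
  a 0%Z = RtoC 0 -> a (Z.of_nat (S p)) = RtoC 0 ->
  csum (fun n => a (Z.of_nat n)) (S p + S p)
  = csum (fun k => a (Z.of_nat (S p) + (Z.of_nat k + 1))%Z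
                   + a (Z.of_nat (S p) - (Z.of_nat k + 1))%Z)%C p.
Proof.
  intros H0 Hp. rewrite csum_split, csum_rev.
  change (csum (fun k => a (Z.of_nat (S p - 1 - k))) (S p))
    with (csum (fun k => a (Z.of_nat (S p - 1 - k))) p + a (Z.of_nat (S p - 1 - p)))%C.
  rewrite csum_first. replace (S p - 1 - p)%nat with 0%nat by lia.
  change (Z.of_nat 0) with 0%Z. rewrite Nat.add_0_r, Hp, H0, csum_plus.
  rewrite (csum_ext (fun k => a (Z.of_nat (S p - 1 - k))) (fun k => a (Z.of_nat (S p) - (Z.of_nat k + 1))%Z)).
  - rewrite (csum_ext (fun k => a (Z.of_nat (S p + S k))) (fun k => a (Z.of_nat (S p) + (Z.of_nat k + 1))%Z)); [ring |].
    intros k Hk. f_equal. lia.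
  - intros k Hk. f_equal. lia.
Qed.

Lemma sum_n_m_csum (f : nat -> C) (n : nat) :
  sum_n_m (G := C_AbelianMonoid) f 1 n = csum (fun k => f (S k)) n.
Proof.
  induction n as [| n IH].
  - rewrite sum_n_m_zero by lia. reflexivity.
  - rewrite sum_n_Sm by lia. rewrite IH. reflexivity.
Qed.

Lemma range_sum_csum (a b : Z) (c : Z -> C) :
  range_sum a b c =
  if (a <=? b)%Z then csum (fun k => c (a + Z.of_nat k)%Z) (Z.to_nat (b - a + 1))
  else (- csum (fun k => c (b + 1 + Z.of_nat k)%Z) (Z.to_nat (a - 1 - b)))%C.
Proof.
  unfold range_sum.
  destruct (a <=? b)%Z; rewrite sum_n_m_csum; [| f_equal]; apply csum_ext; intros k _; f_equal; lia.
Qed.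

Lemma range_sum_ext (a b : Z) (c d : Z -> C) :
  (forall i, c i = d i) -> range_sum a b c = range_sum a b d.
Proof.
  intros H. rewrite !range_sum_csum.
  destruct (a <=? b)%Z; [| f_equal]; apply csum_ext; intros; apply H.
Qed.

Lemma range_sum_scal (a b : Z) (x : C) (c : Z -> C) :
  range_sum a b (fun i => x * c i)%C = (x * range_sum a b c)%C.
Proof.
  rewrite !range_sum_csum. destruct (a <=? b)%Z; rewrite csum_scal; [reflexivity | ring].
Qed.

(** The sign convention for b < a is exactly the one that lets telescoping hold for t <= 0 too. *)
Lemma range_sum_telescope (F : Z -> C) (t : Z) :
  range_sum 1 t (fun i => F i - F (i - 1)%Z)%C = (F t - F 0%Z)%C.
Proof.
  assert (H : forall lo n, csum (fun k => F (lo + 1 + Z.of_nat k)%Z - F (lo + 1 + Z.of_nat k - 1)%Z)%C n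
     = (F (lo + Z.of_nat n)%Z - F lo)%C).
  { intros lo n. induction n as [| n IH].
    - simpl. rewrite Z.add_0_r. ring.
    - simpl csum. rewrite IH. replace (lo + 1 + Z.of_nat n - 1)%Z with (lo + Z.of_nat n)%Z by lia.
      replace (lo + 1 + Z.of_nat n)%Z with (lo + Z.of_nat (S n))%Z by lia. ring. }
  rewrite range_sum_csum. destruct (Z.leb_spec 1 t).
  - rewrite (H 0%Z). do 2 f_equal. lia.
  - rewrite (H t). replace (t + Z.of_nat (Z.to_nat (1 - 1 - t)))%Z with 0%Z by lia. ring.
Qed.

Lemma summable_csum (g : nat -> Z -> C) (n : nat) :
  (forall k, (k < n)%nat -> summable (g k)) ->
  summable (fun i => csum (fun k => g k i) n) /\
  Zseries (fun i => csum (fun k => g k i) n) = csum (fun k => Zseries (g k)) n.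
Proof.
  induction n as [| n IH]; intros H.
  - split; [exact summable_zero | now apply Zseries_zero].
  - destruct IH as [S0 E0]; [intros; apply H; lia |]. simpl. split.
    + apply summable_plus; auto.
    + rewrite Zseries_plus, E0; auto.
Qed.

(** * The Weyl numerator and explicit string functions *)

Section StringFunctions.

Variables (tau : C) (p j r : Z).
Hypothesis Htau : 0 < Im tau.
Hypothesis Hp : (1 <= p)%Z.
Hypothesis Hj : (1 <= j)%Z.

Notation E := (epow tau).
Notation theta := (theta_coef tau).
Notation recip := (recip_coef tau).
Notation K := (Cpow (qpoch_inf (epow tau 1)) 3).
Notation p' := (2 * p + j)%Z.
Notation P := (Z.to_nat p).

(** The terms of Theta_{2r+1,p'}(z; q^p) stripped of the common factor q^[char_weight] z^(-1/2);
    [num_exp_l] holds the negated exponents of z. The series with -(2r+1) has the coefficients at -i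
    and the exponents [num_exp_r]. *)
Definition num_coef (i : Z) : C := E (p * p' * i ^ 2 + p * (2 * r + 1) * i).
Definition num_exp_l (i : Z) : Z := (p' * i + r)%Z.
Definition num_exp_r (i : Z) : Z := (p' * i - r - 1)%Z.

Lemma pp'_pos : 0 < p * p'.
Proof. rewrite <- mult_IZR. apply IZR_lt. nia. Qed.

Lemma num_coef_gauss (f : Z -> C) (b c : R) :
  (forall i : Z, Cmod (f i) = Cmod (E (b * i + c))) ->
  summable (fun i => num_coef i * f i)%C.
Proof.
  intros H.
  apply summable_le with 1 (fun i : Z => E (p * p' * i ^ 2 + (p * (2 * r + 1) + b) * i + c)).
  - intros i. rewrite Cmod_mult, H, <- Cmod_mult, Rmult_1_l. unfold num_coef.
    rewrite <- epow_plus. right. f_equal. f_equal. ring.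
  - apply gauss_summable; trivial. apply pp'_pos.
Qed.

Lemma num_coef_gauss_opp (f : Z -> C) (b c : R) :
  (forall i : Z, Cmod (f i) = Cmod (E (b * i + c))) ->
  summable (fun i => num_coef (- i) * f i)%C.
Proof.
  intros H.
  apply summable_ext with (fun i => num_coef (- i) * f (- - i)%Z)%C.
  - intros i. now rewrite Z.opp_involutive.
  - apply (summable_opp_index (fun i => num_coef i * f (- i)%Z)%C).
    apply num_coef_gauss with (- b) c. intros i. rewrite H, opp_IZR. f_equal. f_equal. ring.
Qed.

Lemma num_coef_summable : summable num_coef.
Proof.
  apply summable_ext with (fun i => num_coef i * 1)%C; [intros; ring |].
  apply num_coef_gauss with 0 0. intros i.
  rewrite Rmult_0_l, Rplus_0_l, epow_0. reflexivity.
Qed.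

Lemma num_coef_opp_summable : summable (fun i => num_coef (- i)).
Proof. apply summable_opp_index, num_coef_summable. Qed.

Definition char_coef (m : Z) : C :=
  (recip_transform tau num_coef num_exp_l m
   - recip_transform tau (fun i => num_coef (- i)) num_exp_r m)%C.

Definition char_numerator (w : C) : C :=
  (Zseries (fun i => num_coef i * epow w (- num_exp_l i))
   - Zseries (fun i => num_coef (- i) * epow w (- num_exp_r i)))%C.

Lemma char_numerator_summable (w : C) :
  summable (fun i => num_coef i * epow w (- num_exp_l i))%C /\
  summable (fun i => num_coef (- i) * epow w (- num_exp_r i))%C.
Proof.
  split.
  - apply num_coef_gauss with (- (p' * (Im w / Im tau))) (- (r * (Im w / Im tau))).
    intros i. rewrite (Cmod_epow_base tau Htau w). unfold num_exp_l. push_IZR.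
    f_equal. f_equal. ring.
  - apply num_coef_gauss_opp with (- (p' * (Im w / Im tau))) ((r + 1) * (Im w / Im tau)).
    intros i. rewrite (Cmod_epow_base tau Htau w). unfold num_exp_r. push_IZR.
    f_equal. f_equal. ring.
Qed.

Lemma char_coef_bound :
  exists M, forall m : Z, Cmod (char_coef m) <= M * Cmod (E (1 * m)) /\
                          Cmod (char_coef m) <= M * Cmod (E (- m)).
Proof.
  assert (L1 : summable (fun i => num_coef i * E (num_exp_l i))%C).
  { apply num_coef_gauss with (IZR p') (IZR r). intros i. unfold num_exp_l. push_IZR. reflexivity. }
  assert (L2 : summable (fun i => num_coef i * E (- num_exp_l i))%C) by exact (proj1 (char_numerator_summable tau)).
  assert (R1 : summable (fun i => num_coef (- i) * E (num_exp_r i))%C).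
  { apply num_coef_gauss_opp with (IZR p') (- r - 1). intros i. unfold num_exp_r. push_IZR.
    f_equal. f_equal. ring. }
  assert (R2 : summable (fun i => num_coef (- i) * E (- num_exp_r i))%C) by exact (proj2 (char_numerator_summable tau)).
  destruct (recip_transform_bound_up tau Htau _ _ num_coef_summable L1) as [M1 [H1 B1]].
  destruct (recip_transform_bound_down tau Htau _ _ num_coef_summable L2) as [M2 [H2 B2]].
  destruct (recip_transform_bound_up tau Htau _ _ num_coef_opp_summable R1) as [M3 [H3 B3]].
  destruct (recip_transform_bound_down tau Htau _ _ num_coef_opp_summable R2) as [M4 [H4 B4]].
  exists (M1 + M2 + M3 + M4). intros m. rewrite Rmult_1_l. unfold char_coef.
  specialize (B1 m). specialize (B2 m). specialize (B3 m). specialize (B4 m).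
  (* Both transforms now have the same limit at +oo, and it cancels in their difference: this is the
     vanishing of the numerator at z = 1. *)
  rewrite (Zseries_opp_index _ num_coef_summable) in B3.
  set (u := recip_transform tau num_coef num_exp_l m) in *.
  set (v := recip_transform tau (fun i => num_coef (- i)) num_exp_r m) in *.
  generalize (Cmod_ge_0 (E m)) (Cmod_ge_0 (E (- m))). intros. split.
  - replace (u - v)%C with ((u - Zseries num_coef) + - (v - Zseries num_coef))%C by ring.
    eapply Rle_trans; [apply Cmod_triangle |]. rewrite Cmod_opp. nra.
  - eapply Rle_trans; [apply Cmod_triangle |]. rewrite Cmod_opp. nra.
Qed.

Lemma char_series_summable (w : C) :
  - Im tau < Im w < Im tau -> summable (fun m => char_coef m * epow w m)%C.
Proof.
  intros Hw. destruct char_coef_bound as [M B].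
  apply (annulus_summable tau 1 M); [intros; apply B | intros; apply B | lra].
Qed.

(** An identity of coefficients for each m, hence valid on the whole annulus although the reciprocal
    series converges only on part of it. *)
Lemma theta_char_series (w : C) :
  - Im tau < Im w < Im tau ->
  (Zseries (fun n => theta n * epow w n) * Zseries (fun m => char_coef m * epow w m)
   = K * char_numerator w)%C.
Proof.
  intros Hw.
  destruct (Zseries_mult _ _ (theta_series_summable tau Htau w) (char_series_summable w Hw)) as [_ <-].
  destruct (char_numerator_summable w) as [N1 N2].
  destruct (coef_pushforward _ _ num_coef_summable w N1) as [S1 E1].
  destruct (coef_pushforward _ _ num_coef_opp_summable w N2) as [S2 E2].
  unfold char_numerator. rewrite <- E1, <- E2.
  rewrite <- Zseries_minus, <- Zseries_scal by (trivial; now apply summable_minus).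
  apply Zseries_ext. intros m.
  assert (T1 := theta_recip_transform_summable tau Htau _ num_exp_l num_coef_summable m).
  assert (T2 := theta_recip_transform_summable tau Htau _ num_exp_r num_coef_opp_summable m).
  transitivity (epow w m * (Zseries (fun k => theta k * recip_transform tau num_coef num_exp_l (m - k))
     - Zseries (fun k => theta k * recip_transform tau (fun i => num_coef (- i)) num_exp_r (m - k))))%C.
  - rewrite <- Zseries_minus by trivial.
    rewrite <- Zseries_scal by now apply summable_minus.
    apply Zseries_ext. intros i. unfold char_coef.
    replace (epow w m) with (epow w i * epow w (m - i)%Z)%C; [ring |].
    rewrite <- epow_plus, <- plus_IZR. do 2 f_equal. lia.
  - rewrite !theta_recip_transform by (trivial; apply num_coef_summable || apply num_coef_opp_summable).
    ring.
Qed.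

(** Up to q^(1/8) z^(-1/2), the even terms of j(z; q) form Theta_{1,2} and the odd ones form
    -Theta_{-1,2}, with the index i reversed. *)
Lemma weyl_denominator_eq (w : C) :
  weyl_denominator w tau
  = (E (1 / 8) * epow w (- (1 / 2)) * Zseries (fun n => theta n * epow w n))%C.
Proof.
  set (f := fun n => (theta n * epow w n)%C).
  assert (Hf : summable f) by now apply theta_series_summable.
  assert (S0 : summable (fun i => f (2 * i)%Z)).
  { apply summable_le with 1 (fun i : Z => E (2 * i ^ 2 + (2 * (Im w / Im tau) - 1) * i + 0)).
    - intros i. unfold f, theta_coef. rewrite !Cmod_mult, Cmod_sg, (Cmod_epow_base tau Htau w), !Rmult_1_l.
      rewrite <- Cmod_mult, <- epow_plus. right. f_equal. f_equal. push_IZR. field. lra.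
    - apply gauss_summable; trivial. lra. }
  assert (S1 : summable (fun i => f (2 * i + 1)%Z)).
  { apply summable_le with 1 (fun i : Z => E (2 * i ^ 2 + (2 * (Im w / Im tau) + 1) * i + Im w / Im tau)).
    - intros i. unfold f, theta_coef. rewrite !Cmod_mult, Cmod_sg, (Cmod_epow_base tau Htau w), !Rmult_1_l.
      rewrite <- Cmod_mult, <- epow_plus. right. f_equal. f_equal. push_IZR. field. lra.
    - apply gauss_summable; trivial. lra. }
  rewrite (proj2 (Zseries_parity f S0 S1)).
  rewrite <- (Zseries_opp_index _ S0), <- (Zseries_opp_index _ S1).
  apply summable_opp_index in S0, S1.
  set (c := (E (1 / 8) * epow w (- (1 / 2)))%C).
  assert (T0 : Theta 1 2 w tau = (c * Zseries (fun n => f (2 * - n)%Z))%C).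
  { rewrite <- Zseries_scal by trivial.
    apply Zseries_ext. intros i. cbv zeta. unfold c, f, theta_coef. rewrite sg_mul_even.
    replace (2 * (i + 1 / (2 * 2)) ^ 2) with (1 / 8 + (2 * - i)%Z * ((2 * - i)%Z - 1) / 2)
      by (push_IZR; field).
    replace (- (2) * (i + 1 / (2 * 2))) with (- (1 / 2) + (2 * - i)%Z) by (push_IZR; field).
    rewrite !epow_plus. ring. }
  assert (T1 : Theta (-1) 2 w tau = (- c * Zseries (fun n => f (2 * - n + 1)%Z))%C).
  { rewrite <- Zseries_scal by trivial.
    apply Zseries_ext. intros i. cbv zeta. unfold c, f, theta_coef. rewrite sg_succ, sg_mul_even.
    replace (2 * (i + -1 / (2 * 2)) ^ 2) with (1 / 8 + (2 * - i + 1)%Z * ((2 * - i + 1)%Z - 1) / 2)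
      by (push_IZR; field).
    replace (- (2) * (i + -1 / (2 * 2))) with (- (1 / 2) + (2 * - i + 1)%Z) by (push_IZR; field).
    rewrite !epow_plus. ring. }
  unfold weyl_denominator. rewrite T0, T1. ring.
Qed.

(** The power of q in the term i = 0 of the two numerator theta series. *)
Definition char_weight : R := p * (2 * r + 1) ^ 2 / (4 * (2 * p + j)).

Lemma p'_neq_0 : 2 * p + j <> 0.
Proof. rewrite <- mult_IZR, <- plus_IZR. apply not_0_IZR. lia. Qed.

Lemma Theta_num_l (w : C) :
  Theta (2 * r + 1) p' w (p * tau)
  = (E char_weight * epow w (- (1 / 2)) * Zseries (fun i => num_coef i * epow w (- num_exp_l i)))%C.
Proof.
  destruct (char_numerator_summable w) as [N1 _].
  rewrite <- Zseries_scal by trivial. apply Zseries_ext. intros i. cbv zeta.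
  assert (H := p'_neq_0).
  rewrite epow_scal_base. unfold num_coef, num_exp_l, char_weight.
  match goal with |- (E ?a * epow w ?b = _)%C =>
    replace a with (p * (2 * r + 1) ^ 2 / (4 * (2 * p + j)) + (p * p' * i ^ 2 + p * (2 * r + 1) * i))
      by (push_IZR; field; trivial);
    replace b with (- (1 / 2) + - (p' * i + r)%Z) by (push_IZR; field; trivial) end.
  rewrite !epow_plus. ring.
Qed.

Lemma Theta_num_r (w : C) :
  Theta (- (2 * r + 1)) p' w (p * tau)
  = (E char_weight * epow w (- (1 / 2)) * Zseries (fun i => num_coef (- i) * epow w (- num_exp_r i)))%C.
Proof.
  destruct (char_numerator_summable w) as [_ N2].
  rewrite <- Zseries_scal by trivial. apply Zseries_ext. intros i. cbv zeta.
  assert (H := p'_neq_0).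
  rewrite epow_scal_base. unfold num_coef, num_exp_r, char_weight.
  match goal with |- (E ?a * epow w ?b = _)%C =>
    replace a with (p * (2 * r + 1) ^ 2 / (4 * (2 * p + j)) + (p * p' * (- i)%Z ^ 2 + p * (2 * r + 1) * (- i)%Z))
      by (push_IZR; field; trivial);
    replace b with (- (1 / 2) + - (p' * i - r - 1)%Z) by (push_IZR; field; trivial) end.
  rewrite !epow_plus. ring.
Qed.

Lemma character_eq (w : C) :
  - Im tau < Im w < Im tau -> weyl_denominator w tau <> RtoC 0 ->
  character p p' (2 * r) w tau
  = (E (char_weight - 1 / 8) / K * Zseries (fun m => char_coef m * epow w m))%C.
Proof.
  intros Hw Hd. unfold character.
  rewrite Theta_num_l, Theta_num_r.
  assert (Q := theta_char_series w Hw).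
  rewrite weyl_denominator_eq in *.
  set (J := Zseries (fun n => theta n * epow w n)%C) in *.
  assert (HJ : J <> RtoC 0).
  { intros H. apply Hd. rewrite H. ring. }
  assert (N : char_numerator w = (/ K * (J * Zseries (fun m => char_coef m * epow w m)))%C).
  { rewrite Q. field. now apply qpoch_inf_neq_0. }
  transitivity (E char_weight * epow w (- (1 / 2)) * char_numerator w
      / (E (1 / 8) * epow w (- (1 / 2)) * J))%C.
  { unfold char_numerator, Cdiv. ring. }
  rewrite N. unfold Rminus. rewrite epow_plus, (epow_opp tau).
  field. repeat split; trivial; (apply epow_neq_0 || now apply qpoch_inf_neq_0).
Qed.

(** The division m / 2 is exact for the even m that matter; its sign is reversed because C_{m,l}
    goes with z^(-m/2). *)
Definition string_coef (m : Z) : C :=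
  (E (char_weight - 1 / 8) / K * (char_coef (- (m / 2)) * E (- (p * m ^ 2 / (4 * j)))))%C.

Lemma pR_neq_0 : IZR p <> 0. Proof. apply not_0_IZR. lia. Qed.
Lemma jR_neq_0 : IZR j <> 0. Proof. apply not_0_IZR. lia. Qed.

(** The level is p'/p - 2 = j/p. *)
Lemma level_exponent (m : Z) : m ^ 2 / (4 * level p p') = p * m ^ 2 / (4 * j).
Proof.
  unfold level. push_IZR. assert (H := pR_neq_0). assert (H' := jR_neq_0).
  field. now split.
Qed.

Lemma string_coef_family : is_string_family p p' (2 * r) tau string_coef.
Proof.
  intros w Hw Hd.
  assert (Hw' : - Im tau < Im w < Im tau).
  { rewrite !Cmod_epow, !Rmult_1_r, <- exp_Ropp, Ropp_involutive in Hw.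
    destruct Hw as [H1 H2]. apply exp_lt_inv in H1, H2.
    assert (0 < 2 * PI) by (generalize PI_RGT_0; lra).
    split; apply Rmult_lt_reg_l with (2 * PI); lra. }
  rewrite character_eq by trivial.
  assert (S0 := Zseries_correct _ (char_series_summable w Hw')).
  (* The term with m = 2n + 2r carries z^(-(n + r)), hence index -(n + r) in the series in z. *)
  apply is_Zseries_opp_index, (is_Zseries_shift r), (is_Zseries_scal (E (char_weight - 1 / 8) / K)%C) in S0.
  revert S0. apply is_Zseries_ext. intros n. cbv zeta.
  rewrite level_exponent. unfold string_coef.
  replace ((2 * n + 2 * r) / 2)%Z with (n + r)%Z
    by (replace (2 * n + 2 * r)%Z with ((n + r) * 2)%Z by lia; now rewrite Z.div_mul by lia).
  replace (- (2 * n + 2 * r)%Z / 2) with (IZR (- (n + r))) by (push_IZR; field).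
  rewrite epow_opp. field. split; [apply epow_neq_0 | now apply qpoch_inf_neq_0].
Qed.

(** Two expansions are compared only on 0 < Im w < Im tau. There the Weyl denominator is nonzero, so
    both are at hand at every point, and this strip is enough for [Laurent_unique]. *)
Lemma string_family_unique (c : Z -> C) (n : Z) :
  is_string_family p p' (2 * r) tau c -> c (2 * n)%Z = string_coef (2 * n).
Proof.
  intros Hc.
  assert (H : forall k, ((c (2 * - k)%Z - string_coef (2 * - k)) * E ((2 * - k)%Z ^ 2 / (4 * level p p')))%C = RtoC 0).
  { apply (Laurent_unique (Im tau)); trivial. intros w Hw.
    assert (A1 : Cmod (E 1) < Cmod (epow w 1) < / Cmod (E 1)).
    { rewrite !Cmod_epow, !Rmult_1_r, <- exp_Ropp, Ropp_involutive.
      assert (0 < 2 * PI) by (generalize PI_RGT_0; lra).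
      split; apply exp_increasing; nra. }
    assert (A2 : weyl_denominator w tau <> RtoC 0).
    { rewrite weyl_denominator_eq. intros Q.
      apply (theta_series_neq_0 tau Htau w Hw).
      apply Cmult_eq_0_reg_l in Q; trivial. intros Q'.
      apply Cmult_eq_0_reg_l in Q'; [| apply epow_neq_0]. now apply epow_neq_0 in Q'. }
    assert (D1 := Hc w A1 A2). assert (D2 := string_coef_family w A1 A2).
    apply (is_Zseries_scal (- (1))%C) in D2.
    assert (D := is_Zseries_plus _ _ _ _ D1 D2).
    apply (is_Zseries_shift (- r)), is_Zseries_opp_index in D.
    match type of D with is_Zseries _ ?l => replace l with (RtoC 0) in D by ring end.
    revert D. apply is_Zseries_ext. intros k. cbv zeta.
    replace (2 * (- k + - r) + 2 * r)%Z with (2 * - k)%Z by lia.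
    replace (- (2 * - k)%Z / 2) with (IZR k) by (push_IZR; field). ring. }
  specialize (H (- n)%Z). rewrite Z.opp_involutive in H.
  rewrite Cmult_comm in H. apply Cmult_eq_0_reg_l in H; [| apply epow_neq_0].
  replace (c (2 * n)%Z) with (string_coef (2 * n) + (c (2 * n)%Z - string_coef (2 * n)))%C by ring.
  rewrite H. ring.
Qed.

Lemma string_function_eq (s : Z) :
  (K * string_function p p' (2 * s) (2 * r) tau
   = E (char_weight - 1 / 8) * E (- (p / j * s ^ 2)) * char_coef (- s))%C.
Proof.
  unfold string_function.
  rewrite string_family_unique.
  - unfold string_coef. replace (2 * s / 2)%Z with s by (now rewrite Z.mul_comm, Z.div_mul by lia).
    replace (- (p * (2 * s)%Z ^ 2 / (4 * j))) with (- (p / j * s ^ 2))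
      by (push_IZR; field; apply jR_neq_0).
    field. now apply qpoch_inf_neq_0.
  - apply epsilon_spec. exists string_coef. apply string_coef_family.
Qed.

(** * The difference of consecutive string functions *)

(** The product of the factors -q^(k+1), ..., -q^(k+n) gathered in n steps of the recursion. *)
Definition geom_coef (k n : Z) : C := (sg n * E (n * (n + 1) / 2 + n * k))%C.

Lemma recip_iter (k : Z) (M : nat) :
  recip k = (csum (fun n => geom_coef k (Z.of_nat n)) M
             + geom_coef k (Z.of_nat M) * recip (k + Z.of_nat M))%C.
Proof.
  induction M as [| M IH].
  - simpl. unfold geom_coef, sg. simpl. rewrite Z.add_0_r.
    replace (0 * (0 + 1) / 2 + 0 * k) with 0 by field. rewrite epow_0. ring.
  - rewrite IH at 1. simpl csum. rewrite <- Cplus_assoc. f_equal.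
    assert (R := recip_coef_rec tau Htau (k + Z.of_nat M)).
    replace (k + Z.of_nat M + 1)%Z with (k + Z.of_nat (S M))%Z in R by lia.
    assert (G : geom_coef k (Z.of_nat (S M)) = (- (geom_coef k (Z.of_nat M) * E ((k + Z.of_nat M)%Z + 1)))%C).
    { unfold geom_coef. replace (Z.of_nat (S M)) with (Z.of_nat M + 1)%Z by lia. rewrite sg_succ.
      replace ((Z.of_nat M + 1)%Z * ((Z.of_nat M + 1)%Z + 1) / 2 + (Z.of_nat M + 1)%Z * k)
        with ((Z.of_nat M * (Z.of_nat M + 1) / 2 + Z.of_nat M * k) + ((k + Z.of_nat M)%Z + 1))
        by (push_IZR; field).
      rewrite (epow_plus _ (_ / 2 + _)). ring. }
    rewrite G.
    replace (recip (k + Z.of_nat M)) with (1 - E ((k + Z.of_nat M)%Z + 1) * recip (k + Z.of_nat (S M)))%C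
      by (rewrite <- R; ring).
    ring.
Qed.

Lemma recip_2p (k : Z) :
  recip k = (csum (fun n => geom_coef k (Z.of_nat n)) (P + P)
             + E (p * (2 * p + 1) + 2 * p * k) * recip (k + 2 * p))%C.
Proof.
  rewrite (recip_iter k (P + P)) at 1. replace (Z.of_nat (P + P)) with (2 * p)%Z by lia.
  f_equal. f_equal. unfold geom_coef. rewrite sg_mul_even, Cmult_1_l. f_equal. push_IZR. field.
Qed.

(** The last two hypotheses are the quasi-periodicity under z -> q^(2p) z: raising i by one raises
    the exponent by 2p + j and multiplies the coefficient by a power of q. Hence -(s - j) + e i + 2p
    = -s + e(i + 1), and the remainder after 2p steps is the transform at -s with i shifted. The
    factor q^(2ps - pj) is the ratio of the normalisations q^(-(p/j) s^2) at s - j and at s. *)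
Lemma recip_transform_step (x : Z -> C) (e : Z -> Z) (s : Z) :
  summable x ->
  (forall n : Z, summable (fun i => x i * E (n * e i))%C) ->
  (forall i, e (i + 1)%Z = (e i + p')%Z) ->
  (forall i, (E (2 * p * s - p * j) * (x i * E (p * (2 * p + 1) + 2 * p * (e i + j - s)%Z)))%C
             = x (i + 1)%Z) ->
  (recip_transform tau x e (- s)
   - E (2 * p * s - p * j) * recip_transform tau x e (- (s - j))
   = - (E (2 * p * s - p * j) * csum (fun n => geom_coef (j - s) (Z.of_nat n)
          * Zseries (fun i => x i * E (Z.of_nat n * e i))) (P + P)))%C.
Proof.
  intros Hx Hn He Hs. set (q0 := E (2 * p * s - p * j)) in *.
  assert (Hr := recip_transform_summable tau Htau x e Hx).
  assert (A : forall i, (x i * recip (- (s - j) + e i))%C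
     = (csum (fun n => geom_coef (j - s) (Z.of_nat n) * (x i * E (Z.of_nat n * e i))) (P + P)
        + / q0 * (x (i + 1)%Z * recip (- s + e (i + 1)%Z)))%C).
  { intros i. rewrite (recip_2p (- (s - j) + e i)), <- (Hs i), (He i).
    replace (- (s - j) + e i + 2 * p)%Z with (- s + (e i + p'))%Z by lia.
    replace (e i + j - s)%Z with (- (s - j) + e i)%Z by lia.
    rewrite Cmult_plus_distr_l, <- csum_scal. f_equal.
    - apply csum_ext. intros n _. unfold geom_coef.
      replace (Z.of_nat n * (Z.of_nat n + 1) / 2 + Z.of_nat n * (- (s - j) + e i)%Z)
        with ((Z.of_nat n * (Z.of_nat n + 1) / 2 + Z.of_nat n * (j - s)%Z) + Z.of_nat n * e i)
        by (push_IZR; ring).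
      rewrite (epow_plus _ (_ / 2 + _)). ring.
    - field. apply epow_neq_0. }
  destruct (summable_csum (fun n i => geom_coef (j - s) (Z.of_nat n) * (x i * E (Z.of_nat n * e i)))%C (P + P)
     (fun n _ => summable_scal _ _ (Hn (Z.of_nat n)))) as [T1 T2].
  assert (R1 := summable_shift 1 _ (Hr (- s)%Z)). cbv beta in R1.
  assert (B : recip_transform tau x e (- (s - j))
     = (csum (fun n => geom_coef (j - s) (Z.of_nat n) * Zseries (fun i => x i * E (Z.of_nat n * e i))) (P + P)
        + / q0 * recip_transform tau x e (- s))%C).
  { unfold recip_transform at 1. rewrite (Zseries_ext _ _ A).
    rewrite Zseries_plus by (trivial; now apply summable_scal). rewrite T2. f_equal.
    - apply csum_ext. intros n _. apply Zseries_scal, Hn.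
    - rewrite Zseries_scal by trivial. f_equal.
      apply (Zseries_shift 1 _ (Hr (- s)%Z)). }
  rewrite B. field. apply epow_neq_0.
Qed.

(** * The numerator at powers of q as a difference of theta functions *)

(** The value of [char_numerator] at w = -n tau. *)
Definition num_at (n : Z) : C :=
  (Zseries (fun i => num_coef i * E (n * num_exp_l i))
   - Zseries (fun i => num_coef (- i) * E (n * num_exp_r i)))%C.

Lemma num_at_summable (n : Z) :
  summable (fun i => num_coef i * E (n * num_exp_l i))%C /\
  summable (fun i => num_coef (- i) * E (n * num_exp_r i))%C.
Proof.
  split.
  - apply num_coef_gauss with (n * p') (n * r); trivial.
    intros i. unfold num_exp_l. push_IZR. f_equal. f_equal. ring.
  - apply num_coef_gauss_opp with (n * p') (- (n * (r + 1))); trivial.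
    intros i. unfold num_exp_r. push_IZR. f_equal. f_equal. ring.
Qed.

Lemma char_coef_step_sum (s : Z) :
  (char_coef (- s) - E (2 * p * s - p * j) * char_coef (- (s - j))
   = - (E (2 * p * s - p * j)
        * csum (fun n => geom_coef (j - s) (Z.of_nat n) * num_at (Z.of_nat n)) (P + P)))%C.
Proof.
  assert (L := recip_transform_step num_coef num_exp_l s num_coef_summable
     (fun n => proj1 (num_at_summable n))).
  assert (R := recip_transform_step (fun i => num_coef (- i)) num_exp_r s
     num_coef_opp_summable (fun n => proj2 (num_at_summable n))).
  unfold char_coef, num_at.
  transitivity ((recip_transform tau num_coef num_exp_l (- s) -
     E (2 * p * s - p * j) * recip_transform tau num_coef num_exp_l (- (s - j)))
   - (recip_transform tau (fun i => num_coef (- i)) num_exp_r (- s) -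
     E (2 * p * s - p * j) * recip_transform tau (fun i => num_coef (- i)) num_exp_r (- (s - j))))%C; [ring |].
  rewrite L, R.
  - rewrite (csum_ext (fun n => _ * (_ - _))%C
      (fun n => geom_coef (j - s) (Z.of_nat n) * Zseries (fun i => num_coef i * E (Z.of_nat n * num_exp_l i))
        + - (1) * (geom_coef (j - s) (Z.of_nat n) * Zseries (fun i => num_coef (- i) * E (Z.of_nat n * num_exp_r i))))%C)
      by (intros; ring).
    rewrite csum_plus, csum_scal. ring.
  - intros i. unfold num_exp_r. lia.
  - intros i. unfold num_coef, num_exp_r. rewrite <- !epow_plus. f_equal. push_IZR. ring.
  - intros i. unfold num_exp_l. lia.
  - intros i. unfold num_coef, num_exp_l. rewrite <- !epow_plus. f_equal. push_IZR. ring.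
Qed.

Definition theta_at (m : Z) : C :=
  jtheta (- E (m * p' + p * (2 * r + 1))) (E (2 * p * p')).

Definition theta_diff (m : Z) : C :=
  (theta_at m - E (m * p' - m * (2 * r + 1)) * theta_at (- m))%C.

(** The minus sign in the argument of the theta function cancels its alternating signs. *)
Lemma theta_at_series (m : Z) :
  theta_at m = Zseries (fun n => E (p * p' * n ^ 2 + (m * p' + p * (2 * r + 1) - p * p') * n)).
Proof.
  unfold theta_at, jtheta. apply Zseries_ext. intros n.
  rewrite Cpowz_opp_epow, Cpowz_epow, IZR_binom2. fold (sg n).
  replace (p * p' * n ^ 2 + (m * p' + p * (2 * r + 1) - p * p') * n)
    with (2 * p * p' * (n * (n - 1) / 2) + (m * p' + p * (2 * r + 1)) * n) by field.
  rewrite epow_plus.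
  transitivity (sg n * sg n * (E (2 * p * p' * (n * (n - 1) / 2)) * E ((m * p' + p * (2 * r + 1)) * n)))%C;
    [ring | rewrite sg_square; ring].
Qed.

Lemma theta_at_summable (m : Z) :
  summable (fun n : Z => E (p * p' * n ^ 2 + (m * p' + p * (2 * r + 1) - p * p') * n)).
Proof.
  apply summable_ext with (fun n : Z => E (p * p' * n ^ 2 + (m * p' + p * (2 * r + 1) - p * p') * n + 0)).
  - intros n. now rewrite Rplus_0_r.
  - apply gauss_summable; trivial. now apply pp'_pos.
Qed.

(** Centring at n = p brings out both theta functions: the first half of the numerator needs a unit
    shift of i, the second the reflection i -> -i. *)
Lemma num_at_theta_diff (m : Z) :
  num_at (p + m) = (E (m * r - p * r - p - m * p') * theta_diff m)%C.
Proof.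
  unfold num_at, theta_diff.
  assert (S1 := summable_shift 1 _ (theta_at_summable m)).
  assert (S2 := summable_opp_index _ (theta_at_summable (- m))).
  rewrite (Zseries_ext (fun i => num_coef i * E ((p + m)%Z * num_exp_l i))%C
    (fun i => E (m * r - p * r - p - m * p') * E (p * p' * (i + 1)%Z ^ 2 + (m * p' + p * (2 * r + 1) - p * p') * (i + 1)%Z))%C).
  2: { intros i. unfold num_coef, num_exp_l. rewrite <- !epow_plus. f_equal. push_IZR. ring. }
  rewrite (Zseries_ext (fun i => num_coef (- i) * E ((p + m)%Z * num_exp_r i))%C
    (fun i => E (m * r - p * r - p - m * p') * E (m * p' - m * (2 * r + 1)) *
       E (p * p' * (- i)%Z ^ 2 + ((- m)%Z * p' + p * (2 * r + 1) - p * p') * (- i)%Z))%C).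
  2: { intros i. unfold num_coef, num_exp_r. rewrite <- !epow_plus. f_equal. push_IZR. ring. }
  rewrite !Zseries_scal by trivial.
  rewrite (Zseries_shift 1 _ (theta_at_summable m)), (Zseries_opp_index _ (theta_at_summable (- m))).
  rewrite <- !theta_at_series. ring.
Qed.

(** Changing the sign of m exchanges the two theta functions. This makes the terms p + m and p - m
    proportional. *)
Lemma theta_diff_opp (m : Z) :
  theta_diff (- m) = (- (E (m * (2 * r + 1) - m * p') * theta_diff m))%C.
Proof.
  unfold theta_diff. rewrite Z.opp_involutive.
  replace (m * (2 * r + 1) - m * p') with (- (m * p' - m * (2 * r + 1))) by ring.
  replace ((- m)%Z * p' - (- m)%Z * (2 * r + 1)) with (- (m * p' - m * (2 * r + 1))) by (push_IZR; ring).
  rewrite epow_opp. field. apply epow_neq_0.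
Qed.

Lemma num_at_p : num_at p = RtoC 0.
Proof.
  replace p with (p + 0)%Z at 1 by lia. rewrite num_at_theta_diff. unfold theta_diff. simpl Z.opp.
  replace (0 * p' - 0 * (2 * r + 1)) with 0 by ring. rewrite (epow_0 tau). ring.
Qed.

(** At z = 1 the two halves differ only by i -> -i. *)
Lemma num_at_0 : num_at 0 = RtoC 0.
Proof.
  unfold num_at.
  rewrite (Zseries_ext _ num_coef), (Zseries_ext (fun i => num_coef (- i) * _)%C (fun i => num_coef (- i))).
  - rewrite (Zseries_opp_index num_coef) by now apply num_coef_summable. ring.
  - intros i. rewrite Rmult_0_l, epow_0. ring.
  - intros i. rewrite Rmult_0_l, epow_0. ring.
Qed.

Lemma char_coef_step (s : Z) :
  (char_coef (- s) - E (2 * p * s - p * j) * char_coef (- (s - j))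
   = sg p * E (binom2 p - p * r + p * s) * range_sum 1 (p - 1) (fun m =>
       sg m * E (binom2 (m + 1) + m * (r - p)) * (E (m * (s - j)) - E (- m * s)) * theta_diff m))%C.
Proof.
  rewrite char_coef_step_sum.
  set (a := fun n : Z => (geom_coef (j - s) n * num_at n)%C).
  change (csum (fun n => geom_coef (j - s) (Z.of_nat n) * num_at (Z.of_nat n))%C (P + P))
    with (csum (fun n => a (Z.of_nat n)) (P + P)).
  assert (HP : exists Q, P = S Q) by (exists (Z.to_nat (p - 1)); lia).
  destruct HP as [Q HQ]. rewrite HQ.
  rewrite (csum_centered a Q).
  2: { unfold a. rewrite num_at_0. ring. }
  2: { unfold a. rewrite <- HQ, Z2Nat.id by lia. rewrite num_at_p. ring. }
  replace (Z.of_nat (S Q)) with p by lia.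
  transitivity (csum (fun k => sg p * E (binom2 p - p * r + p * s) * (
       (fun m : Z => sg m * E (binom2 (m + 1) + m * (r - p)) * (E (m * (s - j)) - E (- m * s)) * theta_diff m) (1 + Z.of_nat k)%Z))%C Q).
  - match goal with |- (- (?x * ?y))%C = _ => replace (- (x * y))%C with (- x * y)%C by ring end.
    rewrite <- csum_scal. apply csum_ext. intros k _. cbv beta.
    rewrite (Z.add_comm 1). set (m := (Z.of_nat k + 1)%Z). unfold a.
    replace (p - m)%Z with (p + - m)%Z by lia.
    rewrite !num_at_theta_diff, theta_diff_opp. unfold geom_coef.
    rewrite !sg_plus, sg_opp, !IZR_binom2.
    (* Both terms are now multiples of [theta_diff m]. For p - m the sign of [theta_diff_opp]
       cancels the overall minus sign, for p + m that sign stays; this gives the difference of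
       q^(m(s-j)) and q^(-ms). *)
    transitivity (sg p * sg m * (
      E ((p + - m)%Z * ((p + - m)%Z + 1) / 2 + (p + - m)%Z * (j - s)%Z + (2 * p * s - p * j)
         + ((- m)%Z * r - p * r - p - (- m)%Z * p') + (m * (2 * r + 1) - m * p'))
      - E ((p + m)%Z * ((p + m)%Z + 1) / 2 + (p + m)%Z * (j - s)%Z + (2 * p * s - p * j)
         + (m * r - p * r - p - m * p'))) * theta_diff m)%C.
    + set (x1 := (p + - m)%Z * ((p + - m)%Z + 1) / 2 + (p + - m)%Z * (j - s)%Z).
      set (x2 := 2 * p * s - p * j).
      set (x3 := (- m)%Z * r - p * r - p - (- m)%Z * p').
      set (x4 := m * (2 * r + 1) - m * p').
      set (y1 := (p + m)%Z * ((p + m)%Z + 1) / 2 + (p + m)%Z * (j - s)%Z).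
      set (y3 := m * r - p * r - p - m * p').
      rewrite !epow_plus. ring.
    + replace ((p + - m)%Z * ((p + - m)%Z + 1) / 2 + (p + - m)%Z * (j - s)%Z + (2 * p * s - p * j)
         + ((- m)%Z * r - p * r - p - (- m)%Z * p') + (m * (2 * r + 1) - m * p'))
        with ((p * (p - 1) / 2 - p * r + p * s) + (((m + 1)%Z * ((m + 1)%Z - 1) / 2 + m * (r - p)) + m * (s - j)))
        by (push_IZR; field).
      replace ((p + m)%Z * ((p + m)%Z + 1) / 2 + (p + m)%Z * (j - s)%Z + (2 * p * s - p * j)
         + (m * r - p * r - p - m * p'))
        with ((p * (p - 1) / 2 - p * r + p * s) + (((m + 1)%Z * ((m + 1)%Z - 1) / 2 + m * (r - p)) + - m * s))
        by (push_IZR; field).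
      set (x1 := p * (p - 1) / 2 - p * r + p * s).
      set (x2 := (m + 1)%Z * ((m + 1)%Z - 1) / 2 + m * (r - p)).
      rewrite !epow_plus. ring.
  - rewrite csum_scal. f_equal. rewrite range_sum_csum. destruct (Z.leb_spec 1 (p - 1)).
    + f_equal. lia.
    (* Here p = 1 and both sums are empty. *)
    + replace Q with 0%nat by lia. replace (Z.to_nat (1 - 1 - (p - 1))) with 0%nat by lia. simpl. ring.
Qed.

End StringFunctions.

(** * Telescoping over i *)

Theorem theorem2p1 (tau : C) (p j r s t : Z)
  (htau : 0 < Im tau)
  (hp : (1 <= p)%Z) (hj : (1 <= j)%Z) (hpj : rel_prime p j)
  (hr : (0 <= 2 * r <= 2 * p + j - 2)%Z) :
  (Cpow (qpoch_inf (epow tau 1)) 3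
     * string_function p (2 * p + j) (2 * j * t + 2 * s) (2 * r) tau
   - Cpow (qpoch_inf (epow tau 1)) 3
     * string_function p (2 * p + j) (2 * s) (2 * r) tau)%C
  =
  (Cpowz (- (1)) p
   * epow tau (- (1 / 8) + p * (2 * r + 1) ^ 2 / (4 * (2 * p + j)))
   * epow tau (binom2 p - p * (r - s) - p / j * s ^ 2)
   * range_sum 1 t (fun i =>
       epow tau (- 2 * p * j * binom2 i - 2 * p * s * i)
       * range_sum 1 (p - 1) (fun m =>
           Cpowz (- (1)) m * epow tau (binom2 (m + 1) + m * (r - p))
           * (epow tau (m * (j * i + s - j)) - epow tau (- m * (j * i + s)))
           * (jtheta (- epow tau (m * (2 * p + j) + p * (2 * r + 1)))
                     (epow tau (2 * p * (2 * p + j)))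
              - epow tau (m * (2 * p + j) - m * (2 * r + 1))
                * jtheta (- epow tau (- m * (2 * p + j) + p * (2 * r + 1)))
                         (epow tau (2 * p * (2 * p + j)))))))%C.
Proof.
  set (F := fun i : Z => (Cpow (qpoch_inf (epow tau 1)) 3
     * string_function p (2 * p + j) (2 * (s + j * i)) (2 * r) tau)%C).
  replace (2 * j * t + 2 * s)%Z with (2 * (s + j * t))%Z by lia.
  replace (2 * s)%Z with (2 * (s + j * 0))%Z at 1 by lia.
  match goal with |- _ = ?x => change ((F t - F 0%Z)%C = x) end.
  rewrite <- (range_sum_telescope F t).
  match goal with |- _ = (?x * range_sum 1 t ?c)%C => rewrite <- (range_sum_scal 1 t x c) end.
  apply range_sum_ext. intros i. unfold F.
  rewrite !string_function_eq by trivial.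
  set (u := (s + j * i)%Z). replace (s + j * (i - 1))%Z with (u - j)%Z by lia.
  assert (Hj0 := jR_neq_0 j hj).
  transitivity (epow tau (char_weight p j r - 1 / 8) * epow tau (- (p / j * u ^ 2))
    * (char_coef tau p j r (- u) - epow tau (2 * p * u - p * j) * char_coef tau p j r (- (u - j))))%C.
  (* Expanding the square yields the very factor q^(2pu - pj) that occurs in [char_coef_step]. *)
  - replace (- (p / j * (u - j)%Z ^ 2)) with (- (p / j * u ^ 2) + (2 * p * u - p * j))
      by (push_IZR; field; trivial).
    rewrite (epow_plus _ (- (p / j * u ^ 2))). ring.
  - rewrite char_coef_step by trivial.
    rewrite (range_sum_ext 1 (p - 1) _ (fun m =>
           Cpowz (- (1)) m * epow tau (binom2 (m + 1) + m * (r - p))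
           * (epow tau (m * (j * i + s - j)) - epow tau (- m * (j * i + s)))
           * (jtheta (- epow tau (m * (2 * p + j) + p * (2 * r + 1)))
                     (epow tau (2 * p * (2 * p + j)))
              - epow tau (m * (2 * p + j) - m * (2 * r + 1))
                * jtheta (- epow tau (- m * (2 * p + j) + p * (2 * r + 1)))
                         (epow tau (2 * p * (2 * p + j)))))%C).
    2: { intros m. unfold theta_diff, theta_at, u, sg. rewrite (opp_IZR m).
         rewrite !(plus_IZR (2 * p)), !(mult_IZR 2 p), !(plus_IZR s), !(mult_IZR j).
         rewrite !(Rplus_comm s). reflexivity. }
    match goal with |- (_ * (_ * _ * ?X))%C = _ => set (Y := X) end.
    fold (sg p).
    transitivity (sg p * epow tau (char_weight p j r - 1 / 8)
      * epow tau (- (p / j * u ^ 2) + (binom2 p - p * r + p * u)) * Y)%C;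
      [rewrite (epow_plus _ (- (p / j * u ^ 2))); ring |].
    (* With u = s + ji, the square contributes -2psi - pj i^2 and the linear term pu contributes
       pji; so -pj (i^2 - i) appears, which is -2pj times the binomial of i. *)
    replace (- (p / j * u ^ 2) + (binom2 p - p * r + p * u))
      with ((binom2 p - p * (r - s) - p / j * s ^ 2) + (- 2 * p * j * binom2 i - 2 * p * s * i))
      by (rewrite (IZR_binom2 i); unfold u; push_IZR; field; trivial).
    rewrite (epow_plus _ (binom2 p - p * (r - s) - p / j * s ^ 2)).
    replace (char_weight p j r - 1 / 8) with (- (1 / 8) + p * (2 * r + 1) ^ 2 / (4 * (2 * p + j)))
      by (unfold char_weight; ring).
    ring.
Qed.
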